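(* Let $n\ge 1$, let $r>0$, and define $$S_{\mathrm{lat},n}=\bigl\{(x,y)\in\mathbb{R}^n\times\mathbb{R}^n : |x|,|y|,|x+y|,|x-y|\in\{0\}\cup[r,\infty)\bigr\}.$$ Suppose $f\colon\mathbb{R}^n\times\mathbb{R}^n\to\mathbb{R}$ is a continuous, integrable function with $\widehat f\ge 0$ everywhere, $\widehat f(0,0)=1$, and $$f(x,y)\le 0\quad\text{for } (x,y)\in S_{\mathrm{lat},n}\setminus\{(0,0)\}.$$ Then $$\operatorname{vol}(B^n_{r/2})\sqrt{f(0,0)}$$ is an upper bound on the optimal lattice sphere packing density in $\mathbb{R}^n$.
   Context: $B^n_\rho$ is the closed ball of radius $\rho$ centered at the origin in $\mathbb{R}^n$. The Fourier transform on $\mathbb{R}^n\times\mathbb{R}^n=\mathbb{R}^{2n}$ is normalized by $\widehat f(w)=\int f(z)e^{-2\pi i\langle z,w\rangle}\,dz$. A lattice sphere packing is a packing of congruent balls with disjoint interiors whose centers form a (full-rank) lattice $\Lambda\subset\mathbb{R}^n$; if the balls have radius $\rho$, its density is $\operatorname{vol}(B^n_\rho)/\operatorname{vol}(\mathbb{R}^n/\Lambda)$. The optimal lattice sphere packing density is the supremum of these densities. *)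

(* Defs.v *)
From HB Require Import structures.
From mathcomp Require Import all_boot all_order all_algebra.
From mathcomp Require Import all_classical all_reals all_analysis.
From mathcomp Require Import complex.
Set Implicit Arguments.
Unset Strict Implicit.
Unset Printing Implicit Defensive.
Import Order.TTheory GRing.Theory Num.Theory.
Import numFieldNormedType.Exports.
Local Open Scope classical_set_scope.
Local Open Scope ring_scope.

(* 'rV[T]_n carries the product sigma-algebra, generated by the coordinates,
   as n.-tuple T does in the library. *)
Definition measure_rV_display : measure_display -> measure_display.
Proof. exact. Qed.

Section measurable_rV.
Context d (T : measurableType d) (n : nat).

Let coors : 'I_n -> 'rV[T]_n -> T := fun i v => v ord0 i.

Let rV_set0 : g_sigma_preimage coors set0.
Proof. exact: sigma_algebra0. Qed.

Let rV_setC A : g_sigma_preimage coors A -> g_sigma_preimage coors (~` A).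
Proof. exact: sigma_algebraC. Qed.

Let rV_bigcup (F : (set 'rV[T]_n)^nat) :
  (forall i, g_sigma_preimage coors (F i)) ->
  g_sigma_preimage coors (\bigcup_i F i).
Proof. exact: sigma_algebra_bigcup. Qed.

HB.instance Definition _ := @isMeasurable.Build (measure_rV_display d)
  'rV[T]_n (g_sigma_preimage coors) rV_set0 rV_setC rV_bigcup.

End measurable_rV.

Lemma measurable_rV_coord d (T : measurableType d) n (i : 'I_n) :
  measurable_fun [set: 'rV[T]_n] (fun v => v ord0 i).
Proof.
move=> _ Y mY; rewrite setTI; apply: sub_sigma_algebra => /=.
rewrite -bigcup_seq/=; exists i => /=; first by rewrite mem_index_enum.
by exists Y => //; rewrite setTI.
Qed.

Lemma measurable_fun_rVP d d' (T : measurableType d) (T' : measurableType d')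
    n (f : T -> 'rV[T']_n) :
  measurable_fun [set: T] f <->
  forall i, measurable_fun [set: T] (fun x => f x ord0 i).
Proof.
split=> [mf i|mf].
  by apply: (measurableT_comp (measurable_rV_coord i) mf).
have : g_sigma_preimage (fun i x => f x ord0 i) `<=` measurable.
  apply: smallest_sub; first exact: sigma_algebra_measurable.
  case: n => [|n] in f mf *; first by rewrite big_ord0.
  rewrite -bigcup_mkord_ord; apply: bigcup_sub => i Ii.
  by move=> A [B mB <-]; exact: mf.
rewrite (@g_sigma_preimage_comp _ _ _ _ (fun i (v : 'rV[T']_n) => v ord0 i)).
by move=> prefS _ A mA; apply: prefS; exists A.
Qed.

Definition row_cons (T : Type) n (p : T * 'rV[T]_n) : 'rV[T]_n.+1 :=
  \row_i if unlift ord0 i is Some j then p.2 ord0 j else p.1.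

Lemma measurable_row_cons d (T : measurableType d) n :
  measurable_fun [set: T * 'rV[T]_n] (@row_cons T n).
Proof.
apply/measurable_fun_rVP => i; case: (unliftP ord0 i) => [j ->|->].
  under eq_fun do rewrite mxE liftK.
  exact: (measurableT_comp (measurable_rV_coord j) measurable_snd).
under eq_fun do rewrite mxE unlift_none.
exact: measurable_fst.
Qed.

Lemma row_cons_preimage (T : Type) n (A : 'I_n.+1 -> set T) :
  @row_cons T n @^-1` [set v | forall i, A i (v ord0 i)] =
  A ord0 `*` [set v : 'rV[T]_n | forall j, A (lift ord0 j) (v ord0 j)].
Proof.
apply/seteqP; split=> [[x v] /= Av|[x v] /= [Ax Av] i].
  split; first by have := Av ord0; rewrite mxE unlift_none.
  by move=> j; have := Av (lift ord0 j); rewrite mxE liftK.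
by rewrite mxE; case: unliftP => [j ->|->].
Qed.

(* The library's sigma-finite instance on m1 \x m2 is shadowed by the one for
   subprobabilities, hence this restatement. *)
Lemma sigma_finite_product d1 d2 (T1 : measurableType d1)
    (T2 : measurableType d2) (R : realType)
    (m1 : {sigma_finite_measure set T1 -> \bar R})
    (m2 : {sigma_finite_measure set T2 -> \bar R}) :
  sigma_finite setT (m1 \x m2)%E.
Proof.
have /sigma_finiteP[F [TF ndF Foo]] := sigma_finiteT m1.
have /sigma_finiteP[G [TG ndG Goo]] := sigma_finiteT m2.
exists (fun n => F n `*` G n).
  rewrite -setXTT TF TG predeqE => -[x y]; split.
    move=> [/= [n _ Fnx] [k _ Gky]]; exists (maxn n k) => //; split.
    - by move: x Fnx; exact/subsetPset/ndF/leq_maxl.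
    - by move: y Gky; exact/subsetPset/ndG/leq_maxr.
  by move=> [n _ []/= ? ?]; split; exists n.
move=> k; have [? ?] := Foo k; have [? ?] := Goo k.
split; first exact: measurableX.
by rewrite product_measure1E// lte_mul_pinfty// ge0_fin_numE.
Qed.

Section lebesgue_rV.
Context (R : realType).

Section step.
Context n (mu : {sigma_finite_measure set 'rV[R]_n -> \bar R}).

Definition lebesgue_rV_step : set 'rV[R]_n.+1 -> \bar R :=
  pushforward (lebesgue_measure \x mu)%E (@row_cons R n).

Let step0 : lebesgue_rV_step set0 = 0%E.
Proof. by rewrite /lebesgue_rV_step /pushforward preimage_set0 measure0. Qed.

Let step_ge0 A : (0 <= lebesgue_rV_step A)%E.
Proof. exact: (measure_ge0 (lebesgue_measure \x mu)%E). Qed.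

Let step_sigma_additive : semi_sigma_additive lebesgue_rV_step.
Proof.
have mrow := @measurable_row_cons _ R n.
move=> F mF tF mUF; rewrite /lebesgue_rV_step /pushforward preimage_bigcup.
apply: measure_semi_sigma_additive.
- by move=> k; rewrite -[X in measurable X]setTI; exact: mrow.
- apply/trivIsetP => /= i j _ _ ij; rewrite -preimage_setI.
  by move/trivIsetP : tF => /(_ _ _ _ _ ij) ->//; rewrite preimage_set0.
- by rewrite -preimage_bigcup -[X in measurable X]setTI; exact: mrow.
Qed.

HB.instance Definition _ := isMeasure.Build _ _ _ lebesgue_rV_step
  step0 step_ge0 step_sigma_additive.

Let step_sigma_finite : sigma_finite setT lebesgue_rV_step.
Proof.
have [F FT Foo] : sigma_finite setT (lebesgue_measure \x mu)%E.
  exact: sigma_finite_product.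
pose tail (v : 'rV[R]_n.+1) := (v ord0 ord0, \row_j v ord0 (lift ord0 j)).
have mtail : measurable_fun setT tail.
  apply/measurable_fun_pairP; split; first exact: measurable_rV_coord.
  apply/measurable_fun_rVP => i /=; under eq_fun do rewrite mxE.
  exact: measurable_rV_coord.
have tailK : cancel (@row_cons R n) tail.
  move=> [x v]; rewrite /tail mxE unlift_none; congr (_, _).
  by apply/rowP => j; rewrite !mxE liftK.
exists (fun k => tail @^-1` F k).
  by rewrite -preimage_bigcup -FT preimage_setT.
move=> k; have [mF Fk] := Foo k; split.
  by rewrite -[X in measurable X]setTI; exact: mtail.
rewrite /lebesgue_rV_step /pushforward -comp_preimage.
by rewrite (_ : tail \o _ = id)//; apply/funext => p /=; rewrite tailK.
Qed.

HB.instance Definition _ := Measure_isSigmaFinite.Build _ _ _ lebesgue_rV_step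
  step_sigma_finite.

End step.

Fixpoint lebesgue_rV n : {sigma_finite_measure set 'rV[R]_n -> \bar R} :=
  if n is m.+1 then lebesgue_rV_step (lebesgue_rV m) else \d_(0 : 'rV[R]_0).

Lemma measurable_box n (A : 'I_n -> set R) :
  (forall i, measurable (A i)) ->
  measurable [set v : 'rV[R]_n | forall i, A i (v ord0 i)].
Proof.
move=> mA.
rewrite (_ : [set v | _] =
    \bigcap_(i in [set` finset.setT]) ((fun v : 'rV[R]_n => v ord0 i) @^-1` A i)).
  apply: fin_bigcap_measurable => // i _; rewrite -[X in measurable X]setTI.
  exact: measurable_rV_coord.
apply/seteqP; split=> [v Av i _|v Av i]; first exact: Av.
by apply: Av; rewrite /= inE.
Qed.

Lemma lebesgue_rV_box n (A : 'I_n -> set R) :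
  (forall i, measurable (A i)) ->
  lebesgue_rV n [set v | forall i, A i (v ord0 i)] =
  (\prod_(i < n) lebesgue_measure (A i))%E.
Proof.
elim: n A => [|n IHn] A mA.
  rewrite big_ord0 /= diracE mem_set//.
  by case.
rewrite big_ord_recl /= /lebesgue_rV_step /pushforward row_cons_preimage.
rewrite product_measure1E; [|exact: mA|].
  rewrite (IHn (fun j => A (lift ord0 j)))//.
exact: (@measurable_box n (fun j => A (lift ord0 j))).
Qed.
End lebesgue_rV.

Section geometry.
Context (R : realType) (n : nat).
Implicit Types (x y : 'rV[R]_n) (A : set 'rV[R]_n) (B : 'M[R]_n).

Definition vol A : R := fine (lebesgue_rV R n A).

Definition dotv x y : R := \sum_i x ord0 i * y ord0 i.

(* Euclidean norm; the library norm `|x| on 'rV[R]_n is the sup norm. *)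
Definition enorm x : R := Num.sqrt (dotv x x).

Definition eball x (rho : R) : set 'rV[R]_n := [set y | enorm (y - x) <= rho].

(* The lattice spanned over the integers by the rows of B; it has full rank
   iff B is invertible. *)
Definition lattice B : set 'rV[R]_n :=
  [set map_mx intr z *m B | z in [set: 'rV[int]_n]].

Definition fundamental_parallelepiped B : set 'rV[R]_n :=
  [set t *m B | t in [set t : 'rV[R]_n | forall i, 0 <= t ord0 i < 1]].

(* vol(R^n / lattice B), as the volume of a fundamental domain *)
Definition covolume B : R := vol (fundamental_parallelepiped B).

Definition is_lattice_packing B (rho : R) : Prop :=
  [/\ B \in unitmx, 0 < rho &
      trivIset (lattice B) (fun x => (eball x rho)°)].

Definition packing_density B (rho : R) : R := vol (eball 0 rho) / covolume B.

Definition optimal_lattice_packing_density : \bar R :=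
  ereal_sup [set (packing_density p.1 p.2)%:E |
             p in [set p | is_lattice_packing p.1 p.2]].

Definition S_lat (r : R) : set ('rV[R]_n * 'rV[R]_n) :=
  let D : set R := [set 0] `|` `[r, +oo[ in
  [set z | [/\ D (enorm z.1), D (enorm z.2),
               D (enorm (z.1 + z.2)) & D (enorm (z.1 - z.2))]].

End geometry.

Section fourier.
Context (R : realType).
Local Open Scope complex_scope.

Definition Cintegral d (T : measurableType d) (mu : {measure set T -> \bar R})
    (F : T -> R[i]) : R[i] :=
  (\int[mu]_t complex.Re (F t)) +i* (\int[mu]_t complex.Im (F t)).

Definition expi (t : R) : R[i] := cos t +i* sin t.

Definition lebesgue_rV2 n : {measure set ('rV[R]_n * 'rV[R]_n) -> \bar R} :=
  (lebesgue_rV R n \x lebesgue_rV R n)%E.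

Definition dotv2 n (z w : 'rV[R]_n * 'rV[R]_n) : R :=
  dotv z.1 w.1 + dotv z.2 w.2.

Definition fourier n (f : 'rV[R]_n * 'rV[R]_n -> R)
    (w : 'rV[R]_n * 'rV[R]_n) : R[i] :=
  Cintegral (lebesgue_rV2 n)
    (fun z => (f z)%:C * expi (- (2 * pi * dotv2 z w))).

End fourier.

(* Main.v *)
(* Replacing a lattice by a multiple, assume that its nonzero vectors have length at least
   r; then f <= 0 at all nonzero points of the lattice squared. By a linear change of
   variables the lattice is Z^n, and the theorem follows from the claim: if F is continuous
   and integrable with nonnegative cosine transform and F <= 0 on the nonzero integer
   points, then the integral of F is at most F(0). (Summability over the integer points is
   not available, so the Poisson summation formula is not used.)

   The hypothesis on the cosine transform is preserved under multiplication by positive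
   mixtures of cosines. One such mixture is the compactly supported tent
   max(0, 1 - |x|), so F may be assumed to have compact support. Another one is
   psi^m, where psi(z) = prod_i cos(pi z_i)^2; as its nonconstant Fourier coefficients are
   nonnegative, the integral of F times the mean of psi^m is at most the integral of
   F psi^m. Since psi < 1 off the integer points, psi^m divided by its mean concentrates on
   the integer points as m grows, and there only F(0) can be positive. *)

From HB Require Import structures.
Require Import Defs.
From mathcomp Require Import all_boot all_order all_algebra.
From mathcomp Require Import all_classical all_reals all_analysis.
From mathcomp Require Import measurable_realfun complex ring lra.
Set Implicit Arguments.
Unset Strict Implicit.
Unset Printing Implicit Defensive.
Import Order.TTheory GRing.Theory Num.Theory.
Import numFieldNormedType.Exports.
Local Open Scope classical_set_scope.
Local Open Scope ring_scope.

(** * Pushforward measures and affine substitutions on the line *)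

Lemma measurable_preimageT d d' (T : measurableType d) (T' : measurableType d')
    (f : T -> T') (A : set T') :
  measurable_fun setT f -> measurable A -> measurable (f @^-1` A).
Proof. by move=> mf mA; rewrite -[X in measurable X]setTI; exact: mf. Qed.

Definition image_measure d d' (T : measurableType d) (T' : measurableType d')
    (R : realType) (m : {measure set T -> \bar R}) (f : T -> T')
    (mf : measurable_fun setT f) : {measure set T' -> \bar R}.
Proof. by refine (pushforward m f : {measure set T' -> \bar R}); exact: mf. Defined.

Section affine.
Context (R : realType).
Notation mu := (@lebesgue_measure R).

Lemma measurable_affine (a b : R) : measurable_fun setT (fun x : R => a * x + b).
Proof.
by apply: continuous_measurable_fun => x; apply: cvgD; [apply: cvgMr|apply: cvg_cst].
Qed.

(** By uniqueness of Lebesgue measure: the pushforward under the affine map, scaled by a, agrees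
    with [mu] on half-open intervals. *)
Lemma lebesgue_measure_affine (a b : R) (A : set R) : 0 < a -> measurable A ->
  mu ((fun x => a * x + b) @^-1` A) = (a^-1%:E * mu A)%E.
Proof.
move=> a0 mA.
have mT := measurable_affine a b.
pose m' : {measure set (measurableTypeR R) -> \bar R} :=
  mscale (NngNum (ltW a0)) (image_measure (T' := measurableTypeR R) mu mT).
suff -> : mu A = m' A.
  by rewrite /m' /mscale /= muleA -EFinM mulVf ?gt_eqF// mul1e.
apply: (@lebesgue_measure_unique R m') => //= _ [[c d] _ <-].
rewrite /m' /mscale /= /pushforward /=.
rewrite (_ : _ @^-1` _ = `]((c - b) / a), ((d - b) / a)]%classic); last first.
  apply/seteqP; split => x /=; rewrite !in_itv /=;
  by rewrite ltr_pdivrMr// ler_pdivlMr// ltrBlDr lerBrDr mulrC.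
rewrite !lebesgue_measure_itv /= !lte_fin ltr_pM2r ?invr_gt0// ltrD2r.
case: ifPn => _; last by rewrite mule0.
rewrite -!EFinB -EFinM; congr EFin.
by field; rewrite gt_eqF.
Qed.

Lemma ge0_integral_affine (a b : R) (f : R -> \bar R) : 0 < a ->
  measurable_fun setT f -> (forall x, 0 <= f x)%E ->
  (\int[mu]_x f (a * x + b)%R = a^-1%:E * \int[mu]_x f x)%E.
Proof.
move=> a0 mf f0.
have mT := measurable_affine a b.
have {}mT : @measurable_fun _ _ (measurableTypeR R) (measurableTypeR R) setT
    (fun x => a * x + b) by [].
have E := @ge0_integral_pushforward _ _ (measurableTypeR R) (measurableTypeR R)
  R _ mT mu setT f measurableT mf (fun x _ => f0 x).
rewrite -[LHS]E.
have ai0 : 0 <= a^-1 by rewrite invr_ge0 ltW.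
rewrite -(@ge0_integral_mscale _ _ R mu setT measurableT (NngNum ai0))//.
by apply: eq_measure_integral => //= A mA _; exact: lebesgue_measure_affine.
Qed.

End affine.

(** * Measurability and translation invariance on R^n *)

Section rV.
Context (R : realType).
Implicit Types (n : nat).

Lemma measurable_mulmx n (M : 'M[R]_n) :
  measurable_fun setT (fun z : 'rV[R]_n => z *m M).
Proof.
apply/measurable_fun_rVP => i; under eq_fun do rewrite mxE.
apply: measurable_sum => j; apply: measurable_funM => //.
exact: measurable_rV_coord.
Qed.

Lemma measurable_rVD d (T : measurableType d) n (f g : T -> 'rV[R]_n) :
  measurable_fun setT f -> measurable_fun setT g ->
  measurable_fun setT (fun x => f x + g x).
Proof.
move=> mf mg; apply/measurable_fun_rVP => i; under eq_fun do rewrite mxE.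
by apply: measurable_funD; apply: (measurableT_comp (measurable_rV_coord i)).
Qed.

Lemma measurable_rVN n : measurable_fun setT (fun z : 'rV[R]_n => - z).
Proof.
apply/measurable_fun_rVP => i; under eq_fun do rewrite mxE.
by apply: measurableT_comp => //; exact: measurable_rV_coord.
Qed.

(** Induction along the construction of [lebesgue_rV]: the sections are shifted by the tail of v,
    the first coordinate by its head. *)
Lemma lebesgue_rV_shift n (v : 'rV[R]_n) (A : set 'rV[R]_n) : measurable A ->
  lebesgue_rV R n ((fun u => u + v) @^-1` A) = lebesgue_rV R n A.
Proof.
elim: n v A => [|n IHn] v A mA.
  congr (_ _); rewrite (_ : (fun u => u + v) = id)//.
  by apply/funext => u; rewrite [LHS]thinmx0 [RHS]thinmx0.
rewrite /= /lebesgue_rV_step /pushforward.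
pose w : 'rV[R]_n := \row_j v ord0 (lift ord0 j).
have mrA : measurable (@row_cons R n @^-1` A).
  exact: measurable_preimageT (@measurable_row_cons _ _ _) mA.
(* The factor 1 puts the shift of the first coordinate into the form of [ge0_integral_affine]. *)
transitivity (\int[lebesgue_measure]_x
    lebesgue_rV R n (xsection (@row_cons R n @^-1` A) (1 * x + v ord0 ord0)%R))%E.
  apply: eq_integral => x _ /=.
  rewrite -[RHS](IHn w); last exact: measurable_xsection.
  congr (_ _); apply/seteqP.
  suff E u : row_cons (x, u) + v = row_cons (1 * x + v ord0 ord0, u + w).
    by split => u; rewrite /xsection /= !inE /= E.
  apply/rowP => i; rewrite !mxE; case: unliftP => [j ->|->] /=.
    by rewrite !mxE.
  by rewrite mul1r.
rewrite (@ge0_integral_affine _ _ _ (fun y =>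
  lebesgue_rV R n (xsection (@row_cons R n @^-1` A) y)))//.
- by rewrite invr1 mul1e.
- exact: measurable_fun_xsection.
Qed.

End rV.

(** * Linear changes of variables *)

Section linear.
Context (R : realType) (n : nat).
Notation lam := (lebesgue_rV R n).
Implicit Types (A : set 'rV[R]_n) (M N : 'M[R]_n).

Let unit_cube : set 'rV[R]_n := [set t | forall i, 0 <= t ord0 i < 1].

Let measurable_unit_cube : measurable unit_cube.
Proof.
exact: (@measurable_box R n (fun=> `[0, 1[%classic) (fun=> measurable_itv _)).
Qed.

Let lebesgue_unit_cube : lam unit_cube = 1%E.
Proof.
have := @lebesgue_rV_box R n (fun=> `[0, 1[%classic) (fun=> measurable_itv _).
rewrite big1; last first.
  by move=> i _; rewrite lebesgue_measure_itv /= lte01 oppr0 adde0.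
by move=> <-.
Qed.

(* The measure of {(x, y) | xN in A, xN + y in Q} (Q the unit cube) computed in both
   orders; in the second one, x is translated by -yN^-1. *)
Lemma lebesgue_rV_mulmx_opp N A : N \in unitmx -> measurable A ->
  (lam [set x | A (x *m N)] = lam [set x | A (- x)%R] * lam [set x | unit_cube (x *m N)])%E.
Proof.
move=> uN mA.
have m1 : measurable_fun setT (fun p : 'rV[R]_n * 'rV[R]_n => p.1 *m N).
  exact: measurableT_comp (measurable_mulmx N) measurable_fst.
have m2 : measurable_fun setT (fun p : 'rV[R]_n * 'rV[R]_n => p.1 *m N + p.2).
  exact: measurable_rVD.
have m3 : measurable_fun setT (fun p : 'rV[R]_n * 'rV[R]_n => p.1 *m N - p.2).
  by apply: measurable_rVD => //; exact: measurableT_comp (@measurable_rVN _ _) measurable_snd.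
have mP (f : 'rV[R]_n * 'rV[R]_n -> 'rV[R]_n) B : measurable_fun setT f -> measurable B ->
    measurable (f @^-1` B) by exact: measurable_preimageT.
pose P := [set p : 'rV[R]_n * 'rV[R]_n | A (p.1 *m N) /\ unit_cube (p.1 *m N + p.2)].
pose Q := [set p : 'rV[R]_n * 'rV[R]_n | A (p.1 *m N - p.2) /\ unit_cube (p.1 *m N)].
have mP' : measurable P.
  by apply: measurableI; [exact: (mP _ _ m1)|exact: (mP _ _ m2)].
have mQ' : measurable Q.
  by apply: measurableI; [exact: (mP _ _ m3)|exact: (mP _ _ m1)].
(* The two iterated measures agree on rectangles, hence on all measurable sets. *)
have swap S : measurable S -> (\int[lam]_x lam (xsection S x) = \int[lam]_x lam (ysection S x))%E.
  move=> mS; have := @product_measure_unique _ _ _ _ R lam lam (lam \x^ lam)%E _ S mS.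
  by apply=> A' B' mA' mB'; exact: (@product_measure2E _ _ _ _ R lam lam).
have PA x : lam (xsection P x) = (\1_[set x | A (x *m N)] x)%:E.
  rewrite indicE; have [Ax|Ax] := boolP (x \in _).
    transitivity (lam unit_cube); last exact: lebesgue_unit_cube.
    rewrite -[RHS](lebesgue_rV_shift (x *m N)) //.
    congr (lam _); apply/seteqP; split=> y; rewrite /xsection /P /= !inE /=.
      by rewrite addrC => -[].
    by rewrite addrC; move: Ax; rewrite inE.
  rewrite (_ : xsection P x = set0) ?measure0//.
  apply/seteqP; split=> // y; rewrite /xsection /= inE => -[Ax' _].
  by case/negP: Ax; rewrite inE.
have PQ y : lam (ysection P y) = lam (ysection Q y).
  rewrite -(lebesgue_rV_shift (- y *m invmx N)); last exact: measurable_ysection.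
  congr (lam _); apply/seteqP.
  suff E x : (x + - y *m invmx N) *m N = x *m N - y.
    by split=> x; rewrite /ysection /P /Q /= !inE /= E subrK.
  by rewrite mulmxDl -mulmxA mulVmx// mulmx1.
(* When x N lies in the cube, the y with x N - y in A form a translate of -A; this is where the
   reflection enters. *)
have QA x : lam (xsection Q x) =
    (lam [set x | A (- x)%R] * (\1_[set x | unit_cube (x *m N)] x)%:E)%E.
  rewrite indicE; have [Ux|Ux] := boolP (x \in _).
    rewrite mule1 -[RHS](lebesgue_rV_shift (- (x *m N))); last first.
      exact: measurable_preimageT (@measurable_rVN _ _) mA.
    congr (lam _); apply/seteqP; split=> y; rewrite /xsection /Q /= !inE /= opprD opprK addrC.
      by case.
    by move: Ux; rewrite inE.
  rewrite mule0 (_ : xsection Q x = set0) ?measure0//.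
  apply/seteqP; split=> // y; rewrite /xsection /= inE => -[_ Ux'].
  by case/negP: Ux; rewrite inE.
have mA' : measurable [set x | A (x *m N)].
  exact: measurable_preimageT (@measurable_mulmx _ _ N) mA.
have mU : measurable [set x | unit_cube (x *m N)].
  exact: measurable_preimageT (@measurable_mulmx _ _ N) measurable_unit_cube.
transitivity (\int[lam]_x lam (xsection P x))%E.
  by under eq_integral do rewrite PA; rewrite integral_indic// setIT.
rewrite swap//; under eq_integral do rewrite PQ.
rewrite -swap//; under eq_integral do rewrite QA.
rewrite ge0_integralZl ?integral_indic ?setIT//.
by apply/measurable_EFinP; exact: measurable_indic.
Qed.

(** The previous lemma with N = 1, since the unit cube has measure 1. *)
Lemma lebesgue_rVN A : measurable A -> lam [set x | A (- x)%R] = lam A.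
Proof.
move=> mA; have := lebesgue_rV_mulmx_opp (unitmx1 _ _) mA.
rewrite (_ : [set x | A _] = A); last by apply/seteqP; split=> x; rewrite /= mulmx1.
move=> ->; rewrite (_ : [set x | unit_cube _] = unit_cube).
  by rewrite lebesgue_unit_cube mule1.
by apply/seteqP; split=> x; rewrite /= mulmx1.
Qed.

Lemma preimage_mulmxV M (P : set 'rV[R]_n) : M \in unitmx ->
  [set x | P (x *m invmx M)] = [set t *m M | t in P].
Proof.
move=> uM; apply/seteqP; split=> [x Px|_ [t Pt <-]] /=; last by rewrite mulmxK.
by exists (x *m invmx M) => //; rewrite mulmxKV.
Qed.

Lemma measurable_fundamental_parallelepiped M : M \in unitmx ->
  measurable (fundamental_parallelepiped M).
Proof.
move=> uM; rewrite /fundamental_parallelepiped -preimage_mulmxV//.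
exact: measurable_preimageT (@measurable_mulmx _ _ _) measurable_unit_cube.
Qed.

(** Lets [covolume], defined through [fine], be converted back to an extended-real measure. *)
Lemma fundamental_parallelepiped_fin_num M : M \in unitmx ->
  lam (fundamental_parallelepiped M) \is a fin_num.
Proof.
move=> uM.
(* With the entries of t in [0, 1), every coordinate of t M is at most C in absolute value. *)
pose C := \sum_i \sum_j `|M i j|.
pose K : set 'rV[R]_n := [set v | forall i, `[- C, C]%classic (v ord0 i)].
have mK : measurable K.
  exact: (@measurable_box R n (fun=> `[- C, C]%classic) (fun=> measurable_itv _)).
rewrite ge0_fin_numE//; apply: (@le_lt_trans _ _ (lam K)).
  apply: le_measure; rewrite ?inE; [exact: measurable_fundamental_parallelepiped|exact: mK|].
  move=> _ [t tP <-] j /=; rewrite in_itv /= -ler_norml mxE.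
  apply: le_trans (ler_norm_sum _ _ _) _; apply: ler_sum => i _.
  rewrite normrM; apply: (@le_trans _ _ (`|M i j|)).
    have /andP[t0 t1] := tP i; rewrite ger0_norm//.
    by rewrite ler_piMl// ltW.
  by rewrite (bigD1 j)//= lerDl sumr_ge0.
rewrite (@lebesgue_rV_box R n (fun=> `[- C, C]%classic) (fun=> measurable_itv _)).
under eq_bigr do rewrite lebesgue_measure_itv /=.
rewrite -[X in (X < _)%E]fineK ?ltry//.
elim/big_ind : _ => // [x y *|i _]; first by rewrite fin_numM.
by case: ifP.
Qed.

(** Take N = M^-1 above: the points that M^-1 sends into the unit cube form the fundamental
    parallelepiped. *)
Lemma lebesgue_rV_mulmx M A : M \in unitmx -> measurable A ->
  lam [set x | A (x *m invmx M)] = ((covolume M)%:E * lam A)%E.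
Proof.
move=> uM mA; rewrite lebesgue_rV_mulmx_opp ?unitmx_inv// lebesgue_rVN// muleC.
congr (_ * _)%E; rewrite /covolume /vol fineK ?fundamental_parallelepiped_fin_num//.
by rewrite preimage_mulmxV.
Qed.

(** For row vectors the parallelepiped of N M is the image under M of that of N, so multiplicativity
    needs no determinants. *)
Lemma covolumeM M N : M \in unitmx -> N \in unitmx ->
  covolume (N *m M) = covolume M * covolume N.
Proof.
move=> uM uN; apply: EFin_inj; rewrite EFinM /covolume /vol.
rewrite !fineK ?fundamental_parallelepiped_fin_num ?unitmx_mul ?uM ?uN//.
rewrite -[X in (X * _)%E]fineK ?fundamental_parallelepiped_fin_num//.
rewrite -lebesgue_rV_mulmx//; last exact: measurable_fundamental_parallelepiped.
rewrite preimage_mulmxV//; congr (lam _); apply/seteqP; split=> [_ [t tP <-]|_ [_ [t tP <-] <-]].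
  by exists (t *m N); rewrite ?mulmxA//; exists t.
by exists t; rewrite ?mulmxA.
Qed.

Lemma covolume1 : covolume (1%:M : 'M[R]_n) = 1.
Proof.
rewrite /covolume /vol (_ : fundamental_parallelepiped _ = unit_cube) ?lebesgue_unit_cube//.
by apply/seteqP; split=> [_ [t tP <-]|t tP]; [rewrite mulmx1|exists t; rewrite ?mulmx1].
Qed.

(** The covolumes of M and M^-1 have product 1, so neither vanishes. *)
Lemma covolume_gt0 M : M \in unitmx -> 0 < covolume M.
Proof.
move=> uM; rewrite lt_neqAle fine_ge0// andbT eq_sym; apply/eqP => cM0.
have uV : invmx M \in unitmx by rewrite unitmx_inv.
have := covolumeM uM uV; rewrite mulVmx// covolume1 cM0 mul0r.
by move/eqP; rewrite oner_eq0.
Qed.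

End linear.

(** * Change of variables on pairs of vectors *)

Section linear2.
Context (R : realType) (n : nat) (M : 'M[R]_n) (uM : M \in unitmx).
Notation lam2 := (lebesgue_rV2 R n).

Definition mulmx2 (z : 'rV[R]_n * 'rV[R]_n) := (z.1 *m M, z.2 *m M).

Lemma measurable_mulmx2 : measurable_fun setT mulmx2.
Proof.
apply/measurable_fun_pairP; split.
  exact: measurableT_comp (measurable_mulmx M) measurable_fst.
exact: measurableT_comp (measurable_mulmx M) measurable_snd.
Qed.

Let k_ge0 : 0 <= covolume M ^+ 2. Proof. exact: sqr_ge0. Qed.

Let lebesgue_rV_mul (A : set 'rV[R]_n) : measurable A ->
  lebesgue_rV R n A = ((covolume M)%:E * lebesgue_rV R n [set x | A (x *m M)])%E.
Proof.
move=> mA; rewrite -lebesgue_rV_mulmx//.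
  by congr (_ _); apply/seteqP; split=> x /=; rewrite mulmxKV.
exact: measurable_preimageT (measurable_mulmx M) mA.
Qed.

(** The scaled pushforward agrees with [lam2] on rectangles, each side of which contributes one
    factor [covolume M]. *)
Lemma ge0_integral_mulmx2 (f : 'rV[R]_n * 'rV[R]_n -> \bar R) :
  measurable_fun setT f -> (forall z, 0 <= f z)%E ->
  (\int[lam2]_z f z = (covolume M ^+ 2)%:E * \int[lam2]_z f (mulmx2 z))%E.
Proof.
move=> mf f0; have mT := measurable_mulmx2.
have E := @ge0_integral_pushforward _ _ _ _ R _ mT lam2 setT f measurableT mf (fun x _ => f0 x).
rewrite -[X in (_ * X)%E]E.
rewrite -(@ge0_integral_mscale _ _ R (image_measure lam2 mT) setT measurableT (NngNum k_ge0))//.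
apply: eq_measure_integral => //= A mA _.
apply: product_measure_unique => // B C mB mC.
transitivity ((covolume M ^+ 2)%:E * lam2 (mulmx2 @^-1` (B `*` C)))%E => //.
have mMB := measurable_preimageT (measurable_mulmx M) mB.
have mMC := measurable_preimageT (measurable_mulmx M) mC.
have -> : lam2 (mulmx2 @^-1` (B `*` C)) =
    (lebesgue_rV R n [set x | B (x *m M)] * lebesgue_rV R n [set x | C (x *m M)])%E.
  exact: (@product_measure1E _ _ _ _ R (lebesgue_rV R n) (lebesgue_rV R n) _ _ mMB mMC).
rewrite (lebesgue_rV_mul mB) (lebesgue_rV_mul mC) expr2 EFinM.
by rewrite !muleA; congr (_ * _)%E; rewrite muleAC.
Qed.

Lemma integrable_mulmx2 (f : 'rV[R]_n * 'rV[R]_n -> \bar R) :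
  lam2.-integrable setT f -> lam2.-integrable setT (f \o mulmx2).
Proof.
move=> /integrableP[mf foo]; apply/integrableP; split.
  exact: measurableT_comp mf measurable_mulmx2.
move: foo; rewrite (ge0_integral_mulmx2 (f := fun z => `|f z|%E)) ?abse_ge0//; last first.
  exact: measurableT_comp.
rewrite -!ge0_fin_numE ?mule_ge0 ?lee_fin ?integral_ge0//.
have c0 : (0 < covolume M ^+ 2)%R by rewrite exprn_gt0// covolume_gt0.
(* An infinite integral of the composite would stay infinite after multiplication by the positive
   constant. *)
rewrite /=; case: (integral _ _ _) => //=.
by rewrite muleC gt0_mulye// lte_fin.
by rewrite muleC gt0_mulNye// lte_fin.
Qed.

Lemma Rintegral_mulmx2 (f : 'rV[R]_n * 'rV[R]_n -> R) :
  lam2.-integrable setT (EFin \o f) ->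
  \int[lam2]_z f z = covolume M ^+ 2 * \int[lam2]_z f (mulmx2 z).
Proof.
move=> fi; have fTi := integrable_mulmx2 fi.
have mf := measurable_int _ fi.
rewrite /Rintegral -[X in X * _]/(fine (covolume M ^+ 2)%:E) -fineM//; last first.
  exact: integrable_fin_num fTi.
congr fine; rewrite [LHS]integralE [in RHS]integralE.
rewrite muleBr//; last first.
  exact: integrable_add_def fTi.
have mp := measurable_funepos mf; have mn := measurable_funeneg mf.
rewrite (ge0_integral_mulmx2 mp)// (ge0_integral_mulmx2 mn)//.
congr (_ * _ - _ * _)%E; apply: eq_integral => z _.
- by rewrite !funeposE.
- by rewrite !funenegE.
Qed.

End linear2.

(** * The tent as a mixture of cosines *)

Section window.
Context (R : realType).
Notation mu := (@lebesgue_measure R).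

Lemma normr_sin_le (x : R) : `|sin x| <= `|x|.
Proof.
have pos (y : R) : 0 <= y -> `|sin y| <= y.
  move=> y0.
  have [c _ +] := @MVT_segment R sin cos 0 y y0 (fun z _ => is_derive_sin z)
    (continuous_subspaceT (@continuous_sin R)).
  rewrite sin0 !subr0 => ->; rewrite normrM (ger0_norm y0).
  by rewrite ler_piMl// cos_max.
have [x0|x0] := leP 0 x; first by rewrite (ger0_norm x0) pos.
by rewrite (ltr0_norm x0) -normrN -sinN pos// oppr_ge0 ltW.
Qed.

(** By the half-angle formula 1 - cos x = 2 sin^2 (x / 2). *)
Lemma cos_ge_quadratic (x : R) : 1 - cos x <= x ^+ 2 / 2.
Proof.
have -> : 1 - cos x = sin (x / 2) ^+ 2 *+ 2.
  have {1}-> : x = (x / 2) *+ 2 by rewrite mulr2n -splitr.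
  by rewrite cos_mulr2n sin2cos2; ring.
have : sin (x / 2) ^+ 2 <= (x / 2) ^+ 2.
  rewrite -[leLHS]real_normK ?num_real// -[leRHS]real_normK ?num_real//.
  by rewrite lerXn2r ?nnegrE// normr_sin_le.
rewrite expr_div_n (_ : 2 ^+ 2 = 4); last by ring.
by move: (sin _ ^+ 2) (x ^+ 2) => u v; lra.
Qed.

Lemma measurable_invr : measurable_fun setT (fun x : R => x^-1).
Proof.
rewrite -(setUv [set 0]); apply/measurable_funU => //; first exact: measurableC.
split; first exact: measurable_fun_set1.
apply: open_continuous_measurable_fun.
  by rewrite openC; exact: closed_eq.
by move=> x; rewrite inE /= => /eqP x0; exact: inv_continuous.
Qed.

(* At [s = 0] the quotient is 0, not its limit [a ^+ 2 / 2]. *)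
Definition osc (a s : R) : R := (1 - cos (a * s)) / s ^+ 2.

Lemma osc_ge0 a s : 0 <= osc a s.
Proof. by rewrite divr_ge0 ?sqr_ge0// subr_ge0 cos_le1. Qed.

Lemma measurable_osc a : measurable_fun setT (osc a).
Proof.
apply: measurable_funM.
  apply: measurable_funB => //; apply: continuous_measurable_fun => s.
  by apply: continuous_comp; [exact: mulrl_continuous|exact: continuous_cos].
apply: (measurableT_comp measurable_invr).
exact: measurable_funX.
Qed.

(** Adding 1 - cos s <= s^2 / 2 and (1 - cos s) s^2 <= 2 s^2 gives (1 - cos s)(1 + s^2) <= (5 / 2)
    s^2. The majorant is integrable, with the arctangent as primitive. *)
Lemma osc_le s : osc 1 s <= 3 * (oneDsqr s)^-1.
Proof.
have [->|s0] := eqVneq s 0.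
  by rewrite /osc expr0n /= invr0 mulr0 mulr_ge0// invr_ge0 (le_trans _ (oneDsqr_ge1 _)).
have s2 : 0 < s ^+ 2 by rewrite exprn_even_gt0.
rewrite /osc mul1r ler_pdivrMr// mulrAC ler_pdivlMr; last first.
  by rewrite (lt_le_trans ltr01)// oneDsqr_ge1.
have := cos_ge_quadratic s; have := cos_geN1 s; rewrite /oneDsqr.
set c := cos s; move: s2; set t := s ^+ 2 => t0 c1 c2.
have : (1 - c) * t <= 2 * t by rewrite ler_wpM2r ?(ltW t0)//; lra.
by lra.
Qed.

Lemma integrable_osc1 : mu.-integrable setT (EFin \o osc 1).
Proof.
apply/integrableP; split; first by apply/measurable_EFinP; exact: measurable_osc.
under eq_integral do rewrite /= ger0_norm ?osc_ge0//.
have mV : measurable_fun setT (fun s : R => (oneDsqr s)^-1).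
  exact: continuous_measurable_fun (@continuous_oneDsqrV R).
apply: (@le_lt_trans _ _ (\int[mu]_s (3%:E * ((oneDsqr s)^-1)%:E))%E).
  apply: ge0_le_integral => //.
  - by move=> s _; rewrite lee_fin osc_ge0.
  - by apply/measurable_EFinP; exact: measurable_osc.
  - by apply/measurable_EFinP; exact: measurable_funM.
  - by move=> s _; rewrite lee_fin osc_le.
have V0 (s : R) : 0 <= (oneDsqr s)^-1.
  by rewrite invr_ge0 (le_trans _ (oneDsqr_ge1 _)).
rewrite ge0_integralZl//; last exact/measurable_EFinP.
rewrite ge0_symfun_integralT//; last 2 first.
- exact: continuous_oneDsqrV.
- by move=> s /=; rewrite /oneDsqr sqrrN.
by rewrite -set_itvcy integral0y_oneDsqr -!EFinM ltry.
Qed.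

(** Since osc a s = a^2 osc 1 (|a| s), the substitution costs one of the two factors |a|. *)
Let osc_scale a : a != 0 ->
  (\int[mu]_s (osc a s)%:E = `|a|%:E * \int[mu]_s (osc 1 s)%:E)%E.
Proof.
move=> a0.
have -> : (\int[mu]_s (osc a s)%:E)%E =
    (\int[mu]_s ((`|a| ^+ 2) * osc 1 (`|a| * s + 0)%R)%:E)%E.
  apply: eq_integral => s _; congr EFin; rewrite /osc mul1r addr0.
  rewrite -(cos_norm (a * s)) -(cos_norm (`|a| * s)) !normrM normr_id exprMn.
  have [->|s0] := eqVneq s 0; first by rewrite expr0n /= mulr0 !invr0 !mulr0.
  by field; rewrite s0 normr_eq0.
under eq_integral do rewrite EFinM.
rewrite (@ge0_integral_affine _ _ _ (fun s => (`|a| ^+ 2)%:E * (osc 1 s)%:E)%E) ?normr_gt0//.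
- rewrite ge0_integralZl//.
  + rewrite muleA -EFinM; congr (_%:E * _)%E.
    by field; rewrite normr_eq0.
  + by apply/measurable_EFinP; exact: measurable_osc.
  + by move=> s _; rewrite lee_fin osc_ge0.
- by apply/measurable_EFinP/measurable_funM => //; exact: measurable_osc.
- by move=> s; rewrite -EFinM lee_fin mulr_ge0 ?sqr_ge0 ?osc_ge0.
Qed.

Lemma integral_osc a :
  (\int[mu]_s (osc a s)%:E = `|a|%:E * \int[mu]_s (osc 1 s)%:E)%E.
Proof.
have [->|] := eqVneq a 0; last exact: osc_scale.
rewrite normr0 mul0e integral0_eq// => s _.
by rewrite /osc mul0r cos0 subrr mul0r.
Qed.

Lemma integrable_osc a : mu.-integrable setT (EFin \o osc a).
Proof.
apply/integrableP; split; first by apply/measurable_EFinP; exact: measurable_osc.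
under eq_integral do rewrite /= ger0_norm ?osc_ge0//.
rewrite integral_osc -(fineK (integrable_fin_num measurableT integrable_osc1)).
by rewrite -EFinM ltry.
Qed.

(** Its classical value is pi. *)
Definition osc_mass : R := \int[mu]_s osc 1 s.

Lemma Rintegral_osc a : \int[mu]_s osc a s = `|a| * osc_mass.
Proof.
rewrite /osc_mass /Rintegral integral_osc fineM//.
exact: integrable_fin_num integrable_osc1.
Qed.

(** On [pi / 2, pi] the cosine is at most 0, so the integrand is at least 1 / pi^2 there. *)
Lemma osc_mass_gt0 : 0 < osc_mass.
Proof.
have pi0 := pi_gt0 R.
have I : (((pi ^+ 2)^-1 * (pi / 2))%:E <= \int[mu]_s (osc 1 s)%:E)%E.
  apply: (@le_trans _ _ (\int[mu]_(s in `[(pi / 2)%R, pi]) cst (pi ^+ 2)^-1%R%:E s)%E).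
    rewrite integral_cst//= lebesgue_measure_itv /= lte_fin ifT; last by lra.
    by rewrite -EFinB -EFinM lee_fin ler_pM2l ?invr_gt0 ?exprn_gt0//; lra.
  apply: (@le_trans _ _ (\int[mu]_(s in `[(pi / 2)%R, pi]) (osc 1 s)%:E)%E).
    apply: ge0_le_integral => //.
    - by move=> s _; rewrite lee_fin invr_ge0 sqr_ge0.
    - apply/measurable_EFinP; apply: measurable_funS (measurable_osc 1) => //.
    move=> s; rewrite /= in_itv /= => /andP[s1 s2]; rewrite lee_fin /osc mul1r.
    have s0 : 0 < s by lra.
    rewrite -[leLHS]mul1r ler_pM ?invr_ge0 ?sqr_ge0//; last first.
      by rewrite lef_pV2 ?posrE ?exprn_gt0// lerXn2r ?nnegrE; lra.
    rewrite lerBrDr gerDl -(cos_pihalf R) leNgt.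
    rewrite ltr_cos ?in_itv /=; [rewrite -leNgt; lra|lra|lra].
  apply: ge0_subset_integral => //.
  - by apply/measurable_EFinP; exact: measurable_osc.
  - by move=> s _; rewrite lee_fin osc_ge0.
rewrite -lte_fin /osc_mass /Rintegral fineK; last first.
  exact: integrable_fin_num integrable_osc1.
by apply: lt_le_trans I; rewrite lte_fin mulr_gt0 ?invr_gt0 ?exprn_gt0 ?divr_gt0.
Qed.

Definition tent (x : R) : R := Num.max 0 (1 - `|x|).

(** By the addition formulas the integrand is half of [osc (x + 1)] plus half of [osc (x - 1)] minus
    [osc x]. As [osc a] integrates to |a| times the mass, what appears is half the second difference
    of the absolute value, which is the tent. *)
Lemma Rintegral_osc_cos x : \int[mu]_s (osc 1 s * cos (x * s)) = osc_mass * tent x.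
Proof.
have ie a k : mu.-integrable setT (EFin \o (fun s => k * osc a s)).
  by have := integrableZl measurableT k (integrable_osc a).
transitivity (\int[mu]_s (2^-1 * osc (x + 1) s + 2^-1 * osc (x - 1) s - 1 * osc x s)).
  apply: eq_Rintegral => s _; rewrite /osc !(mulrDl x) mulNr !mul1r !cosD cosN sinN.
  by move: (s ^+ 2)^-1 => t; field.
have i2 : mu.-integrable setT (EFin \o (fun s => 2^-1 * osc (x + 1) s + 2^-1 * osc (x - 1) s)).
  by have := integrableD measurableT (ie (x + 1) 2^-1) (ie (x - 1) 2^-1).
rewrite (RintegralB measurableT i2 (ie _ _)) (RintegralD measurableT (ie _ _) (ie _ _)).
rewrite !RintegralZl ?Rintegral_osc//; try exact: integrable_osc.
rewrite /tent mulrC.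
have [x0|x0] := leP 0 x; [rewrite !(ger0_norm x0)|rewrite !(ltr0_norm x0)].
  have -> : `|x + 1| = x + 1 by rewrite ger0_norm// addr_ge0.
  have [x1|x1] := leP 0 (1 - x).
    by rewrite ler0_norm; [field|lra].
  by rewrite ger0_norm; [field|lra].
have -> : `|x - 1| = 1 - x by rewrite ler0_norm ?opprB; lra.
have [x1|x1] := leP 0 (1 - - x).
  by rewrite ger0_norm; [field|lra].
by rewrite ler0_norm; [field|lra].
Qed.

End window.

(** * Functions with nonnegative cosine transform *)

Lemma EFin_Rintegral d (T : measurableType d) (R : realType)
    (m : {measure set T -> \bar R}) (f : T -> R) :
  m.-integrable setT (EFin \o f) ->
  (\int[m]_x (f x)%:E)%E = (\int[m]_x f x)%:E.
Proof. by move=> fi; rewrite fineK//; exact: integrable_fin_num fi. Qed.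

Section posdef.
Context (R : realType) (n : nat).
Notation Z := ('rV[R]_n * 'rV[R]_n)%type.
Notation lam2 := (lebesgue_rV2 R n).
Notation mu := (@lebesgue_measure R).

Lemma sigma_finite_lebesgue_rV2 : sigma_finite setT lam2.
Proof. exact: sigma_finite_product. Qed.

(** Bundles [lebesgue_rV2] as a sigma-finite measure, so that Fubini's theorem applies to its
    product with the line. *)
Definition lebesgue_rV2_sf : {sigma_finite_measure set Z -> \bar R} :=
  let m := Measure.sort lam2 in
  HB.pack_for {sigma_finite_measure set Z -> \bar R} m
    (Measure.class lam2)
    (Measure_isSigmaFinite.Build _ _ _ m sigma_finite_lebesgue_rV2).


Lemma dotv2Dr (z w u : Z) : dotv2 z (w + u) = dotv2 z w + dotv2 z u.
Proof.
rewrite /dotv2 /dotv addrACA; congr (_ + _); rewrite -big_split /=;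
by apply: eq_bigr => i _; rewrite mxE mulrDr.
Qed.

Lemma dotv2Zr (z u : Z) (s : R) : dotv2 z (s *: u) = s * dotv2 z u.
Proof.
rewrite /dotv2 /dotv mulrDr !mulr_sumr; congr (_ + _);
by apply: eq_bigr => i _; rewrite mxE mulrCA.
Qed.

Lemma dotv2Br (z w u : Z) : dotv2 z (w - u) = dotv2 z w - dotv2 z u.
Proof. by rewrite dotv2Dr -scaleN1r dotv2Zr mulN1r. Qed.

Lemma measurable_dotv2 (w : Z) : measurable_fun setT (fun z : Z => dotv2 z w).
Proof.
apply: measurable_funD; apply: measurable_sum => i; apply: measurable_funM => //.
- exact: measurableT_comp (measurable_rV_coord i) measurable_fst.
- exact: measurableT_comp (measurable_rV_coord i) measurable_snd.
Qed.

Lemma measurable_cos_dotv2 (w : Z) :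
  measurable_fun setT (fun z : Z => cos (dotv2 z w)).
Proof.
apply: measurableT_comp (measurable_dotv2 w).
exact: continuous_measurable_fun (@continuous_cos R).
Qed.

Lemma integrable_mul_le1 d (T : measurableType d) (m : {measure set T -> \bar R})
    (F h : T -> R) : m.-integrable setT (EFin \o F) ->
  measurable_fun setT h -> (forall x, `|h x| <= 1) ->
  m.-integrable setT (EFin \o (fun x => F x * h x)).
Proof.
move=> Fi mh h1; have mF := measurable_int _ Fi.
apply: le_integrable Fi => //=.
  by apply/measurable_EFinP; apply: measurable_funM => //; exact/measurable_EFinP.
by move=> x _; rewrite lee_fin normrM ler_piMr.
Qed.

(* For continuous F the condition says, by Bochner's theorem, that the even part of F is
   positive definite. *)
Definition posdef (F : Z -> R) := lam2.-integrable setT (EFin \o F) /\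
  forall w, 0 <= \int[lam2]_z (F z * cos (dotv2 z w)).

Lemma integrable_cos_dotv2 F w : lam2.-integrable setT (EFin \o F) ->
  lam2.-integrable setT (EFin \o (fun z => F z * cos (dotv2 z w))).
Proof.
move=> Fi; apply: integrable_mul_le1 => //; first exact: measurable_cos_dotv2.
by move=> z; exact: cos_max.
Qed.

Lemma cosM (x y : R) : cos x * cos y = 2^-1 * cos (x + y) + 2^-1 * cos (x - y).
Proof. by rewrite cosD cosB; field. Qed.

(** The cosine transform of the product at w is the mean of those of F at u + w and u - w. *)
Lemma posdef_cos F u : posdef F -> posdef (fun z => F z * cos (dotv2 z u)).
Proof.
move=> [Fi F0]; split; first exact: integrable_cos_dotv2.
move=> w.
rewrite (_ : \int[lam2]_z _ = 2^-1 * \int[lam2]_z (F z * cos (dotv2 z (u + w)))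
   + 2^-1 * \int[lam2]_z (F z * cos (dotv2 z (u - w)))).
  by rewrite addr_ge0// mulr_ge0.
have Fiw v := integrable_cos_dotv2 v Fi.
have Fik v : lam2.-integrable setT (EFin \o (fun z => 2^-1 * (F z * cos (dotv2 z v)))).
  by have := integrableZl measurableT 2^-1 (Fiw v).
rewrite -!RintegralZl// -RintegralD//.
apply: eq_Rintegral => z _.
by rewrite -mulrA cosM dotv2Dr dotv2Br; ring.
Qed.

Lemma tent_bound (x : R) : 0 <= tent x <= 1.
Proof. by rewrite /tent le_max lexx ge_max ler01 /= gerBl normr_ge0. Qed.

Lemma tentE (x : R) : tent x = (1 - `|x| + `|1 - `|x| |) / 2.
Proof.
rewrite /tent; have [h|h] := leP 0 (1 - `|x|); first by rewrite (ger0_norm h); field.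
by rewrite (ltr0_norm h); field.
Qed.

Lemma continuous_tent : continuous (@tent R).
Proof.
rewrite (funext tentE) => x; apply: cvgMl.
have c1 : {for x, continuous (fun y : R => 1 - `|y|)}.
  by apply: cvgB; [exact: cvg_cst|exact: norm_continuous].
by apply: cvgD => //; exact: cvg_norm c1.
Qed.

Lemma measurable_tent : measurable_fun setT (@tent R).
Proof. exact: continuous_measurable_fun continuous_tent. Qed.

(* Exchange the integral over z with the integral over s of Rintegral_osc_cos. *)
Lemma posdef_tent F u : posdef F -> posdef (fun z => F z * tent (dotv2 z u)).
Proof.
move=> PF; have [Fi F0] := PF.
have mt : measurable_fun setT (fun z : Z => tent (dotv2 z u)).
  exact: measurableT_comp measurable_tent (measurable_dotv2 u).
have t1 z : `|tent (dotv2 z u)| <= 1.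
  by have /andP[t0 t1] := tent_bound (dotv2 z u); rewrite ger0_norm.
have Fti := integrable_mul_le1 Fi mt t1.
split=> // w.
have mF : measurable_fun setT F by apply/measurable_EFinP; exact: measurable_int Fi.
have Fwi := integrable_cos_dotv2 w Fi.
pose H (p : Z * R) := F p.1 * cos (dotv2 p.1 w) * (osc 1 p.2 * cos (dotv2 p.1 u * p.2)).
have mH : measurable_fun setT H.
  apply: measurable_funM; first apply: measurable_funM.
  - exact: measurableT_comp mF measurable_fst.
  - exact: measurableT_comp (measurable_cos_dotv2 w) measurable_fst.
  apply: measurable_funM.
    exact: measurableT_comp (measurable_osc 1) measurable_snd.
  apply: (measurableT_comp (continuous_measurable_fun (@continuous_cos R))).
  apply: measurable_funM => //.
  exact: measurableT_comp (measurable_dotv2 u) measurable_fst.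
(* By Tonelli: for fixed z, the integral of |H| over s is at most |F z| times [osc_mass]. *)
have iH : (lebesgue_rV2_sf \x mu)%E.-integrable setT (EFin \o H).
  have mHE : measurable_fun setT (EFin \o H) by exact/measurable_EFinP.
  apply/(integrable12ltyP lebesgue_rV2_sf mu mHE).
  apply: (@le_lt_trans _ _ (\int[lam2]_z (`|F z| * osc_mass R)%R%:E)%E).
    apply: ge0_le_integral => //.
    - by move=> z _; exact: integral_ge0.
    - apply: (measurable_fun_fubini_tonelli_F (m2 := mu) (abse \o (EFin \o H))) => [|p].
        exact: measurableT_comp.
      exact: abse_ge0.
    - by apply/measurable_EFinP; apply: measurable_funM => //; exact: measurableT_comp.
    move=> z _.
    rewrite EFinM -EFin_Rintegral; last exact: integrable_osc1.
    rewrite -ge0_integralZl//; last 2 first.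
    - by apply/measurable_EFinP; exact: measurable_osc.
    - by move=> s _; rewrite lee_fin osc_ge0.
    under [leRHS]eq_integral do rewrite -EFinM.
    apply: ge0_le_integral => //.
    - apply: measurableT_comp => //; apply: measurableT_comp mHE _.
      exact: measurable_pair1.
    - by apply/measurable_EFinP; apply: measurable_funM => //; exact: measurable_osc.
    move=> s _; rewrite /= lee_fin /H /= normrM (normrM (F z)) (normrM (osc 1 s)).
    rewrite ler_pM ?mulr_ge0//; first by rewrite ler_piMr ?cos_max.
    by rewrite (ger0_norm (osc_ge0 _ _)) ler_piMr ?osc_ge0 ?cos_max.
  under eq_integral do rewrite EFinM.
  rewrite ge0_integralZr//; last 2 first.
  - by apply/measurable_EFinP; exact: measurableT_comp.
  - by rewrite lee_fin ltW// osc_mass_gt0.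
  have /integrableP[_] := Fi; rewrite -ge0_fin_numE ?integral_ge0// => /fineK <-.
  by rewrite -EFinM ltry.
have Hs z : (\int[mu]_s (EFin \o H) (z, s) =
    (osc_mass R * (F z * tent (dotv2 z u) * cos (dotv2 z w)))%:E)%E.
  have iosc := integrable_mul_le1 (integrable_osc1 R)
    (continuous_measurable_fun (_ : continuous (fun s => cos (dotv2 z u * s))))
    (fun s => cos_max _).
  have ci : continuous (fun s => cos (dotv2 z u * s)).
    by move=> s; apply: continuous_comp; [exact: mulrl_continuous|exact: continuous_cos].
  rewrite /= /H /=.
  rewrite EFin_Rintegral; last first.
    by have := integrableZl measurableT (F z * cos (dotv2 z w)) (iosc ci).
  rewrite RintegralZl//; last exact: iosc.
  by rewrite Rintegral_osc_cos; congr EFin; ring.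
have := Fubini iH; under eq_integral do rewrite Hs.
rewrite EFin_Rintegral; last first.
  have := integrableZl measurableT (osc_mass R) (integrable_cos_dotv2 w Fti).
  by [].
rewrite RintegralZl//; last exact: integrable_cos_dotv2.
move=> E; rewrite -(pmulr_rge0 _ (osc_mass_gt0 R)) -lee_fin E.
apply: integral_ge0 => s _.
(* In the other order, the inner integral at s is the nonnegative [osc 1 s] times the cosine
   transform at w of F multiplied by the cosine of frequency s u. *)
have [Fsi Fs0] := posdef_cos (s *: u) PF.
rewrite (_ : (\int[_]_x _)%E =
    (osc 1 s * \int[lam2]_z (F z * cos (dotv2 z (s *: u)) * cos (dotv2 z w)))%:E).
  by rewrite lee_fin mulr_ge0 ?osc_ge0.
rewrite -RintegralZl//; last exact: integrable_cos_dotv2.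
rewrite -EFin_Rintegral; last first.
  by have := integrableZl measurableT (osc 1 s) (integrable_cos_dotv2 w Fsi).
by apply: eq_integral => z _; rewrite /H /= dotv2Zr (mulrC s); congr EFin; ring.
Qed.

End posdef.

(** * Powers of cosine *)

Section cos_power.
Context (R : realType).
Notation mu := (@lebesgue_measure R).

(** A nonnegative function of period 1; for m > 0 it equals 1 exactly at the integers. *)
Definition cos2X (m : nat) (x : R) : R := (cos (pi * x) ^+ 2) ^+ m.

Lemma cos2X_ge0 m x : 0 <= cos2X m x.
Proof. by rewrite exprn_ge0// sqr_ge0. Qed.

Lemma cos2_le1 (x : R) : cos x ^+ 2 <= 1.
Proof. by rewrite -real_normK ?num_real// exprn_ile1// cos_max. Qed.

Lemma cos2X_le1 m x : cos2X m x <= 1.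
Proof. by rewrite exprn_ile1 ?sqr_ge0// cos2_le1. Qed.

Lemma continuous_cos2X m : continuous (cos2X m).
Proof.
move=> x; apply: (@continuous_comp _ _ _ (fun x => cos (pi * x) ^+ 2) (fun y => y ^+ m)).
  apply: (@continuous_comp _ _ _ (fun x => cos (pi * x)) (fun y => y ^+ 2)).
    by apply: continuous_comp; [exact: mulrl_continuous|exact: continuous_cos].
  exact: exprn_continuous.
exact: exprn_continuous.
Qed.

(** A finite cosine series as a list of coefficients and frequencies, with repetitions allowed.
    Multiplying by cos^2 (pi x) splits a term of frequency k into one half at k and one quarter at
    each of k + 1 and k - 1, so coefficients stay nonnegative. *)
Lemma cos2X_expansion m : exists2 s : seq (R * int), all (fun p => 0 <= p.1) s &
  forall x, cos2X m x = \sum_(p <- s) p.1 * cos (2 * pi * p.2%:~R * x).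
Proof.
elim: m => [|m [s s0 sE]].
  by exists [:: (1, 0)] => [|x]; rewrite /= ?ler01// big_seq1 mulr0 mul0r cos0 mulr1.
exists (flatten [seq [:: (p.1 / 2, p.2); (p.1 / 4, p.2 + 1); (p.1 / 4, p.2 - 1)] | p <- s]).
  elim: s s0 {sE} => //= p s IH /andP[p0 /IH ->].
  by rewrite !divr_ge0.
move=> x; rewrite /cos2X exprSr -/(cos2X m x) sE big_flatten /= big_map mulr_suml.
apply: eq_bigr => p _; rewrite 2!big_cons big_seq1 /=.
have cosE (y z : R) : cos z * cos y ^+ 2 =
    cos z / 2 + cos (z + y *+ 2) / 4 + cos (z - y *+ 2) / 4.
  by rewrite cosB cosD cos_mulr2n; field.
have -> : 2 * pi * (p.2 + 1)%:~R * x = 2 * pi * p.2%:~R * x + (pi * x) *+ 2.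
  by rewrite intrD; ring.
have -> : 2 * pi * (p.2 - 1)%:~R * x = 2 * pi * p.2%:~R * x - (pi * x) *+ 2.
  by rewrite intrB; ring.
by rewrite -mulrA cosE; field.
Qed.

Lemma sin_pi_int (k : int) : sin (pi * k%:~R : R) = 0.
Proof.
have nat_case (j : nat) : sin (pi * j%:R : R) = 0.
  elim: j => [|j IH]; first by rewrite mulr0 sin0.
  by rewrite -natr1 mulrDr mulr1 sinDpi IH oppr0.
by case: k => j; rewrite ?NegzE ?mulrNz ?mulrN ?sinN nat_case ?oppr0.
Qed.

Lemma Rintegral_cos_period (k : int) (L : nat) :
  \int[mu]_(x in `[- (L%:R / 2), L%:R / 2]) cos (2 * pi * k%:~R * x) =
  L%:R * (k == 0)%:R.
Proof.
have [->|k0] := eqVneq k 0.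
  under eq_Rintegral do rewrite mulr0 mul0r cos0.
  rewrite Rintegral_cst//= lebesgue_measure_itv /= lte_fin.
  case: ifPn => [_ /=|]; first by rewrite mul1r mulr1; field.
  rewrite -leNgt mulr0 mulr1 => L0; have : 0 <= L%:R :> R by [].
  by lra.
rewrite mulr0; case: L => [|L].
  by rewrite mul0r oppr0 set_itv1 Rintegral_set1.
pose c : R := 2 * pi * k%:~R.
have c0 : c != 0.
  by rewrite mulf_neq0 ?intr_eq0// mulf_neq0// gt_eqF ?pi_gt0.
pose F x := c^-1 * sin (c * x).
have dF (x : R) : is_derive x (1 : R) F (cos (c * x)).
  have d1 : is_derive x (1 : R) (fun y => c *: y) (c *: 1) by exact: is_deriveZ.
  have d2 : is_derive x (1 : R) (sin \o (fun y => c *: y)) (cos (c * x) * (c *: 1)).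
    exact: is_derive1_comp.
  have E : c^-1 *: (cos (c * x) * (c *: 1)) = cos (c * x).
    by rewrite /GRing.scale /= mulr1 mulrCA mulVf// mulr1.
  by have := is_deriveZ c^-1 d2; rewrite E.
have cF : continuous F.
  by move=> x; apply: differentiable_continuous; apply/derivable1_diffP; exact: ex_derive.
have L0 : - (L.+1%:R / 2) < L.+1%:R / 2 :> R.
  have : 0 < L.+1%:R :> R by [].
  by lra.
rewrite /Rintegral (@continuous_FTC2 _ _ F)//.
- rewrite -EFinB /= /F mulrN sinN.
  (* The primitive is a multiple of the sine, and the ends of the interval correspond to integer
     multiples of pi. *)
  have -> : c * (L.+1%:R / 2) = pi * (k * L.+1%:Z)%:~R.
    by rewrite intrM /c; field.
  by rewrite sin_pi_int oppr0 !mulr0 subrr.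
- apply: continuous_subspaceT => x.
  by apply: continuous_comp; [exact: mulrl_continuous|exact: continuous_cos].
- split.
  + by move=> x _; have [] := dF x.
  + by apply: cvg_at_right_filter; exact: cF.
  + by apply: cvg_at_left_filter; exact: cF.
- by move=> x _; rewrite derive1E; have [_ ->] := dF x.
Qed.

Lemma integrable_cont_itv (f : R -> R) (a b : R) : continuous f ->
  mu.-integrable `[a, b] (EFin \o f).
Proof.
move=> cf; apply: continuous_compact_integrable; first exact: segment_compact.
exact: continuous_subspaceT.
Qed.

Definition cos2X_mass m : R := \int[mu]_(x in `[- (1 / 2), 1 / 2]) cos2X m x.

Lemma Rintegral_cos_sum (s : seq (R * int)) (L : nat) :
  \int[mu]_(x in `[- (L%:R / 2), L%:R / 2])
    (\sum_(p <- s) p.1 * cos (2 * pi * p.2%:~R * x)) =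
  L%:R * \sum_(p <- s | p.2 == 0) p.1.
Proof.
have cc (k : R) : continuous (fun x => cos (k * x)).
  by move=> x; apply: continuous_comp; [exact: mulrl_continuous|exact: continuous_cos].
have cs (t : seq (R * int)) :
    continuous (fun x => \sum_(p <- t) p.1 * cos (2 * pi * p.2%:~R * x)).
  elim: t => [|p t IH] x.
    by under eq_fun do rewrite big_nil; exact: cvg_cst.
  by under eq_fun do rewrite big_cons; apply: cvgD; [apply: cvgMr; exact: cc|exact: IH].
elim: s => [|p s IH].
  by under eq_Rintegral do rewrite big_nil; rewrite big_nil mulr0 Rintegral_cst// mul0r.
under eq_Rintegral do rewrite big_cons.
rewrite RintegralD//; last 2 first.
- apply: integrable_cont_itv => x; apply: cvgMr; exact: cc.
- exact: integrable_cont_itv (cs s).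
rewrite IH RintegralZl//; last exact: integrable_cont_itv.
by rewrite Rintegral_cos_period big_cons; case: eqP => _ /=; ring.
Qed.

(** Only the terms of frequency 0 survive; the case L = 1 identifies the sum of their coefficients
    with the mass. *)
Lemma Rintegral_cos2X m (L : nat) :
  \int[mu]_(x in `[- (L%:R / 2), L%:R / 2]) cos2X m x = L%:R * cos2X_mass m.
Proof.
have [s _ sE] := cos2X_expansion m.
have aux (K : nat) : \int[mu]_(x in `[- (K%:R / 2), K%:R / 2]) cos2X m x =
    K%:R * \sum_(p <- s | p.2 == 0) p.1.
  by under eq_Rintegral do rewrite sE; exact: Rintegral_cos_sum.
by rewrite aux; congr (_ * _); rewrite -[LHS]mul1r; exact/esym/(aux 1%N).
Qed.

(** The cosine is even and decreases on [0, pi / 2], so on [-d, d] the function is at least its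
    value at d. *)
Lemma cos2X_mass_ge m (d : R) : 0 < d <= 1 / 2 ->
  2 * d * cos2X m d <= cos2X_mass m.
Proof.
move=> /andP[d0 d1].
have pi0 := pi_gt0 R.
have mc := continuous_measurable_fun (@continuous_cos2X m).
rewrite -lee_fin /cos2X_mass /Rintegral fineK; last first.
  apply: integrable_fin_num => //.
  by apply: integrable_cont_itv; exact: continuous_cos2X.
apply: (@le_trans _ _ (\int[mu]_(x in `[(- d)%R, d]) cst (cos2X m d)%:E x)%E).
  rewrite integral_cst//= lebesgue_measure_itv /= lte_fin ifT; last by lra.
  by rewrite -EFinB -EFinM lee_fin mulrC opprK -mulr2n mulr_natl.
apply: (@le_trans _ _ (\int[mu]_(x in `[(- d)%R, d]) (cos2X m x)%:E)%E).
  apply: ge0_le_integral => //.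
  - by move=> x _; rewrite lee_fin cos2X_ge0.
  - by apply/measurable_EFinP; apply: measurable_funTS.
  move=> x; rewrite /= in_itv /= -ler_norml => xd; rewrite lee_fin.
  rewrite lerXn2r ?nnegrE ?sqr_ge0// -(cos_norm (pi * x)) normrM (gtr0_norm pi0).
  rewrite lerXn2r ?nnegrE//.
  - by apply: cos_ge0_pihalf; apply/andP; split; nra.
  - by apply: cos_ge0_pihalf; have := normr_ge0 x; move: `|x| xd => y *; apply/andP; split; nra.
  have := normr_ge0 x; move: `|x| xd => y yd y0.
  rewrite leNgt ltr_cos ?in_itv /=; [|apply/andP; split; nra..].
  by rewrite -leNgt ler_pM2l.
apply: ge0_subset_integral => //.
- by apply/measurable_EFinP; apply: measurable_funTS.
- by move=> x _; rewrite lee_fin cos2X_ge0.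
- by move=> x; rewrite /= !in_itv /= => /andP[x1 x2]; apply/andP; split; lra.
Qed.

End cos_power.

(** * Products over the coordinates *)

Section product_integral.
Context (R : realType).
Notation mu := (@lebesgue_measure R).

(** Tonelli's theorem, splitting off the first coordinate through [row_cons]. *)
Lemma integral_prod_coord (g : R -> R) (c : R) n : measurable_fun setT g ->
  (forall x, 0 <= g x) -> (\int[mu]_x (g x)%:E = c%:E)%E ->
  (\int[lebesgue_rV R n]_v (\prod_(i < n) g (v ord0 i))%:E = (c ^+ n)%:E)%E.
Proof.
move=> mg g0 gc.
have mP k : measurable_fun setT (fun v : 'rV[R]_k => \prod_(i < k) g (v ord0 i)).
  apply: measurable_prod => i _.
  exact: measurableT_comp mg (measurable_rV_coord i).
have P0 k (v : 'rV[R]_k) : 0 <= \prod_(i < k) g (v ord0 i) by exact: prodr_ge0.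
elim: n => [|n IH].
  under eq_integral do rewrite big_ord0.
  by rewrite integral_cst//= diracE mem_set// mule1.
have rowE (p : R * 'rV[R]_n) : \prod_(i < n.+1) g (row_cons p ord0 i) =
    g p.1 * \prod_(i < n) g (p.2 ord0 i).
  rewrite big_ord_recl /row_cons mxE unlift_none.
  by under eq_bigr do rewrite mxE liftK.
rewrite /= /lebesgue_rV_step.
have mr := @measurable_row_cons _ R n.
have mE := (measurable_EFinP _ _).2 (mP n.+1).
have mPn := (measurable_EFinP _ _).2 (mP n).
have mgE := (measurable_EFinP _ _).2 mg.
have E := @ge0_integral_pushforward _ _ (measurableTypeR R * 'rV[R]_n)%type _ R _ mr
  (mu \x lebesgue_rV R n)%E setT _ measurableT mE (fun v _ => P0 n.+1 v).
rewrite [LHS]E preimage_setT.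
have mF : measurable_fun setT (fun p : R * 'rV[R]_n =>
    (g p.1 * \prod_(i < n) g (p.2 ord0 i))%:E).
  apply/measurable_EFinP; apply: measurable_funM.
    exact: measurableT_comp mg measurable_fst.
  exact: measurableT_comp (mP n) measurable_snd.
transitivity (\int[mu \x lebesgue_rV R n]_p (g p.1 * \prod_(i < n) g (p.2 ord0 i))%:E)%E.
  by apply: eq_integral => p _; exact: congr1 (rowE p).
have T := @fubini_tonelli1 _ _ (measurableTypeR R) _ R mu (lebesgue_rV R n) _ mF.
rewrite {}[LHS]T => [|p]; last by rewrite lee_fin mulr_ge0.
rewrite /fubini_F /=.
transitivity (\int[mu]_x ((g x)%:E * (c ^+ n)%:E))%E.
  apply: eq_integral => x _.
  under eq_integral do rewrite EFinM.
  rewrite ge0_integralZl ?lee_fin//; first by rewrite IH.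
  by move=> v _; rewrite lee_fin; exact: P0.
have c0 : 0 <= c.
  by rewrite -lee_fin -gc; apply: integral_ge0 => x _; rewrite lee_fin.
rewrite ge0_integralZr ?lee_fin ?exprn_ge0//;
  [|by move=> y _; rewrite lee_fin].
by rewrite gc -EFinM exprS.
Qed.

End product_integral.

Section box_product.
Context (R : realType) (n : nat).
Notation Z := ('rV[R]_n * 'rV[R]_n)%type.
Notation lam2 := (lebesgue_rV2 R n).

Definition boxprod (g : R -> R) (z : Z) : R :=
  (\prod_i g (z.1 ord0 i)) * (\prod_i g (z.2 ord0 i)).

Lemma boxprod_ge0 (g : R -> R) z : (forall x, 0 <= g x) -> 0 <= boxprod g z.
Proof. by move=> g0; rewrite mulr_ge0// prodr_ge0. Qed.

Lemma boxprod_le1 (g : R -> R) z : (forall x, 0 <= g x <= 1) -> boxprod g z <= 1.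
Proof.
move=> g01; have p1 (v : 'rV[R]_n) : 0 <= \prod_i g (v ord0 i) <= 1.
  apply: (big_ind (fun x => 0 <= x <= 1)) => [|a b /andP[a0 a1] /andP[b0 b1]|i _] //.
    by rewrite ler01 lexx.
  by rewrite mulr_ge0 ?mulr_ile1.
have /andP[a0 a1] := p1 z.1; have /andP[b0 b1] := p1 z.2.
by rewrite mulr_ile1.
Qed.

Lemma boxprodM (g h : R -> R) z :
  boxprod (fun x => g x * h x) z = boxprod g z * boxprod h z.
Proof. by rewrite /boxprod !big_split /= mulrACA. Qed.

Lemma boxprodX (g : R -> R) m z : boxprod (fun x => g x ^+ m) z = boxprod g z ^+ m.
Proof. by rewrite /boxprod exprMn !prodrXl. Qed.

Lemma measurable_boxprod (g : R -> R) : measurable_fun setT g ->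
  measurable_fun setT (boxprod g).
Proof.
move=> mg; apply: measurable_funM; apply: measurable_prod => i _;
  apply: (measurableT_comp mg); apply: (measurableT_comp (measurable_rV_coord i)).
- exact: measurable_fst.
- exact: measurable_snd.
Qed.

Lemma integral_boxprod (g : R -> R) (c : R) : measurable_fun setT g ->
  (forall x, 0 <= g x) -> (\int[lebesgue_measure]_x (g x)%:E = c%:E)%E ->
  (\int[lam2]_z (boxprod g z)%:E = (c ^+ (n + n))%:E)%E.
Proof.
move=> mg g0 gc.
have mE : measurable_fun setT (fun z => (boxprod g z)%:E).
  by apply/measurable_EFinP; exact: measurable_boxprod.
have T := @fubini_tonelli1 _ _ _ _ R (lebesgue_rV R n) (lebesgue_rV R n) _ mE.
rewrite {}[LHS]T => [|z]; last by rewrite lee_fin boxprod_ge0.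
rewrite /fubini_F /=.
have mP : measurable_fun setT (fun v : 'rV[R]_n => (\prod_i g (v ord0 i))%:E).
  apply/measurable_EFinP; apply: measurable_prod => i _.
  exact: measurableT_comp mg (measurable_rV_coord i).
have P0 (v : 'rV[R]_n) : (0 <= (\prod_i g (v ord0 i))%:E)%E.
  by rewrite lee_fin prodr_ge0.
have IP := integral_prod_coord n mg g0 gc.
have c0 : 0 <= c.
  by rewrite -lee_fin -gc; apply: integral_ge0 => x _; rewrite lee_fin.
transitivity (\int[lebesgue_rV R n]_x ((\prod_i g (x ord0 i))%:E * (c ^+ n)%:E))%E.
  apply: eq_integral => x _.
  rewrite /boxprod /=; under eq_integral do rewrite EFinM.
  by rewrite ge0_integralZl ?IP ?lee_fin ?prodr_ge0.
rewrite ge0_integralZr ?lee_fin ?exprn_ge0//.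
by rewrite IP -EFinM exprD.
Qed.

Let basis : seq Z := [seq (delta_mx 0 i, 0) | i <- enum 'I_n] ++
  [seq (0, delta_mx 0 i) | i <- enum 'I_n].

Let size_basis : size basis = (n + n)%N.
Proof. by rewrite size_cat; congr addn; rewrite size_map size_enum_ord. Qed.

(** Coordinates become pairings with basis vectors, the form in which [posdef_tent] and
    [posdef_cos2X] act; products are then handled by induction over the list of vectors. *)
Let boxprodE g z : boxprod g z = \prod_(u <- basis) g (dotv2 z u).
Proof.
have d0 (x : 'rV[R]_n) : dotv x 0 = 0.
  by rewrite /dotv big1// => i _; rewrite mxE mulr0.
have dd (x : 'rV[R]_n) i : dotv x (delta_mx 0 i) = x ord0 i.
  rewrite /dotv (bigD1 i)//= mxE !eqxx mulr1 big1 ?addr0// => j ji.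
  by rewrite mxE (negbTE ji) andbF mulr0.
rewrite big_cat; congr (_ * _); rewrite big_map big_enum /=; apply: eq_bigr => i _.
  by rewrite /dotv2 /= d0 dd addr0.
by rewrite /dotv2 /= d0 dd add0r.
Qed.

Lemma posdef0 : posdef (fun _ : Z => 0 : R).
Proof.
split=> [|w]; first exact: integrable0.
by apply: Rintegral_ge0 => z _; rewrite mul0r.
Qed.

Lemma posdefD (F G : Z -> R) : posdef F -> posdef G -> posdef (fun z => F z + G z).
Proof.
move=> [Fi F0] [Gi G0]; split=> [|w]; first by have := integrableD measurableT Fi Gi.
under eq_Rintegral do rewrite mulrDl.
by rewrite RintegralD ?addr_ge0//; exact: integrable_cos_dotv2.
Qed.

Lemma posdefZ (a : R) (F : Z -> R) : 0 <= a -> posdef F -> posdef (fun z => a * F z).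
Proof.
move=> a0 [Fi F0]; split=> [|w]; first by have := integrableZl measurableT a Fi.
under eq_Rintegral do rewrite -mulrA.
by rewrite RintegralZl ?mulr_ge0//; exact: integrable_cos_dotv2.
Qed.

Lemma Rintegral_posdef_ge0 (F : Z -> R) : posdef F -> 0 <= \int[lam2]_z F z.
Proof.
move=> [_ /(_ 0)]; under eq_Rintegral do rewrite -(scale0r 0) dotv2Zr mul0r cos0 mulr1.
by [].
Qed.

(** Each term of the cosine expansion preserves [posdef]. The terms of frequency 0 contribute the
    mass times the integral of F, and the others a nonnegative amount. *)
Lemma posdef_cos2X (F : Z -> R) m u : posdef F ->
  posdef (fun z => F z * cos2X m (dotv2 z u)) /\
  cos2X_mass R m * \int[lam2]_z F z <= \int[lam2]_z (F z * cos2X m (dotv2 z u)).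
Proof.
move=> PF; have [Fi _] := PF.
have [s s0 sE] := cos2X_expansion R m.
have -> : cos2X_mass R m = \sum_(p <- s | p.2 == 0) p.1.
  rewrite -[LHS]mul1r -[1]/(1%:R) -(Rintegral_cos2X R m 1).
  under eq_Rintegral do rewrite sE.
  by rewrite Rintegral_cos_sum mul1r.
have -> : (fun z => F z * cos2X m (dotv2 z u)) =
    (fun z => \sum_(p <- s) p.1 * (F z * cos (dotv2 z ((2 * pi * p.2%:~R) *: u)))).
  apply/funext => z; rewrite sE mulr_sumr; apply: eq_bigr => p _.
  by rewrite dotv2Zr mulrCA.
elim: s s0 {sE} => [_|p s IH /= /andP[p0 /IH[Ps Is]]].
  split; first by under eq_fun do rewrite big_nil; exact: posdef0.
  by rewrite big_nil mul0r; apply: Rintegral_ge0 => z _; rewrite big_nil.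
have Pp := posdefZ p0 (posdef_cos ((2 * pi * p.2%:~R) *: u) PF).
split; first by under eq_fun do rewrite big_cons; exact: posdefD.
under [leRHS]eq_Rintegral do rewrite big_cons.
rewrite RintegralD//; [|exact: (Pp.1)|exact: (Ps.1)].
rewrite big_cons; case: eqP => [->|_]; last first.
  by rewrite -[leLHS]add0r lerD// Rintegral_posdef_ge0.
rewrite mulrDl lerD//.
under [leRHS]eq_Rintegral do rewrite mulr0 scale0r -(scale0r 0) dotv2Zr mul0r cos0 mulr1.
by rewrite RintegralZl.
Qed.

(** The weight is applied one coordinate at a time, each giving one factor of the mass; the product
    stays [posdef] for the next one. *)
Lemma posdef_boxprod_cos2X (F : Z -> R) m : posdef F ->
  cos2X_mass R m ^+ (n + n) * \int[lam2]_z F z <=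
  \int[lam2]_z (F z * boxprod (cos2X m) z).
Proof.
move=> PF; under [leRHS]eq_Rintegral do rewrite boxprodE.
rewrite -size_basis; elim: basis F PF => [|u us IH] F PF.
  by under [leRHS]eq_Rintegral do rewrite big_nil mulr1; rewrite mul1r.
have [Pu Iu] := posdef_cos2X m u PF.
under [leRHS]eq_Rintegral do rewrite big_cons mulrA.
apply: le_trans (IH _ Pu).
rewrite /= exprSr -mulrA ler_wpM2l// exprn_ge0//.
by apply: Rintegral_ge0 => x _; exact: cos2X_ge0.
Qed.

Lemma posdef_boxprod_tent (F : Z -> R) (s : R) : posdef F ->
  posdef (fun z => F z * boxprod (fun x => tent (s * x)) z).
Proof.
move=> PF; rewrite (_ : (fun z => _) =
    (fun z => F z * \prod_(u <- basis) tent (dotv2 z (s *: u)))); last first.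
  apply/funext => z; rewrite boxprodE; congr (_ * _).
  by apply: eq_bigr => u _; rewrite dotv2Zr.
elim: basis F PF => [|u us IH] F PF.
  by under eq_fun do rewrite big_nil mulr1.
under eq_fun do rewrite big_cons mulrA.
by apply: IH; exact: posdef_tent.
Qed.

End box_product.

(** * Comparison of the integral with the value at the origin *)

Lemma exists_expr_lt (R : realType) (x e : R) : 0 <= x < 1 -> 0 < e ->
  exists m, x ^+ m < e.
Proof.
move=> /andP[x0 x1] e0.
have xn : `|x| < 1 by rewrite ger0_norm.
have /cvgrPdist_lt/(_ _ e0)[m _ /(_ m (leqnn m))] := cvg_expr xn.
rewrite /= sub0r normrN => h; exists m; exact: le_lt_trans (ler_norm _) h.
Qed.

(** Here sin (pi x) = 0, so with k the floor of x also sin (pi (x - k)) = 0, whereas the sine is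
    positive on (0, pi). *)
Lemma cos2X_eq1 (R : realType) (x : R) : cos2X 1 x = 1 -> x \is a Num.int.
Proof.
rewrite /cos2X expr1 => /eqP.
rewrite -subr_eq0 -opprB oppr_eq0 -sin2cos2 sqrf_eq0 => /eqP s0.
have /andP[kx xk] := floor_itv x; set k := Num.floor x in kx xk.
have E : sin (pi * x) = sin (pi * (x - k%:~R)) * cos (pi * k%:~R).
  rewrite -{1}(subrK k%:~R x) mulrDr sinD sin_pi_int mulr0 addr0.
  by [].
have ck : cos (pi * k%:~R : R) != 0.
  apply/eqP => c0; have := cos2Dsin2 (pi * k%:~R : R).
  by rewrite c0 sin_pi_int expr0n addr0 => /esym/eqP; rewrite oner_eq0.
move: E; rewrite s0 => /esym/eqP; rewrite mulf_eq0 (negbTE ck) orbF => /eqP st0.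
suff -> : x = k%:~R by exact: intr_int.
apply/eqP; rewrite -subr_eq0; apply/negPn/negP => t0.
have tp : 0 < x - k%:~R by rewrite lt_neqAle eq_sym t0 subr_ge0.
have : 0 < sin (pi * (x - k%:~R)).
  apply: sin_gt0_pi; rewrite mulr_gt0 ?pi_gt0//= -[ltRHS]mulr1 ltr_pM2l ?pi_gt0//.
  by rewrite ltrBlDl -[X in _ < _ + X]/(1%:~R) -intrD.
by rewrite st0 ltxx.
Qed.

Section summation.
Context (R : realType) (n : nat).
Notation Z := ('rV[R]_n * 'rV[R]_n)%type.
Notation lam2 := (lebesgue_rV2 R n).
Notation N := (n + n)%N.

Lemma norm_leP (z : Z) (r : R) : 0 <= r ->
  reflect ((forall i, `|z.1 ord0 i| <= r) /\ (forall i, `|z.2 ord0 i| <= r)) (`|z| <= r).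
Proof.
move=> r0.
have rVP (v : 'rV[R]_n) : reflect (forall i, `|v ord0 i| <= r) (`|v| <= r).
  rewrite /Num.norm /= mx_normrE; apply: (iffP (bigmax_leP _ _ _ _)).
    by move=> [_ vr] i; exact: (vr (ord0, i)).
  move=> vr; split=> // -[j i] _ /=; rewrite (ord1 j); exact: vr.
rewrite (prod_normE z) ge_max; apply: (iffP andP).
  by move=> [/rVP z1 /rVP z2]; split.
by move=> [z1 z2]; split; exact/rVP.
Qed.

Lemma boxprod_le_coord (g : R -> R) (z : Z) i : (forall x, 0 <= g x <= 1) ->
  boxprod g z <= g (z.1 ord0 i) /\ boxprod g z <= g (z.2 ord0 i).
Proof.
move=> g01.
have p01 (v : 'rV[R]_n) (P : pred 'I_n) : 0 <= \prod_(j | P j) g (v ord0 j) <= 1.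
  apply: (big_ind (fun x => 0 <= x <= 1)) => [|a b /andP[a0 a1] /andP[b0 b1]|j _] //.
    by rewrite ler01 lexx.
  by rewrite mulr_ge0 ?mulr_ile1.
have pi (v : 'rV[R]_n) : \prod_j g (v ord0 j) <= g (v ord0 i).
  have /andP[g0 _] := g01 (v ord0 i).
  by rewrite (bigD1 i)//= ler_piMr//; case/andP: (p01 v (fun j => j != i)).
have /andP[a0 a1] := p01 z.1 xpredT; have /andP[b0 b1] := p01 z.2 xpredT.
split; rewrite /boxprod.
  by apply: le_trans (pi z.1); rewrite ler_piMr.
by apply: le_trans (pi z.2); rewrite ler_piMl.
Qed.

Lemma continuous_boxprod (g : R -> R) : continuous g -> continuous (@boxprod R n g).
Proof.
move=> cg.
have cp (p : Z -> 'rV[R]_n) : continuous p ->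
    continuous (fun z => \prod_i g (p z ord0 i)).
  move=> cpp; elim: (index_enum _) => [|i s IH] z.
    by under eq_fun do rewrite big_nil; exact: cvg_cst.
  under eq_fun do rewrite big_cons.
  apply: cvgM; last exact: IH.
  apply: (@continuous_comp _ _ _ (fun z => p z ord0 i) g); last exact: cg.
  apply: (@continuous_comp _ _ _ p (fun v => v ord0 i)); first exact: cpp.
  exact: coord_continuous.
by move=> z; apply: cvgM; [apply: (cp fst)|apply: (cp snd)] => {}z; [exact: cvg_fst|exact: cvg_snd].
Qed.

Lemma compact_box (r : R) : compact [set z : Z | `|z| <= r].
Proof.
have cV : compact [set v : 'rV[R]_n | `|v| <= r].
  apply: bounded_closed_compact.
    by exists r; split=> [|x rx v /= vr]; [exact: num_real|rewrite (le_trans vr)// ltW].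
  by apply: (@preimage_closed _ _ _ [set x | x <= r]);
    [move=> v _; exact: norm_continuous|exact: closed_le].
rewrite (_ : mkset _ = [set v : 'rV[R]_n | `|v| <= r] `*` [set v : 'rV[R]_n | `|v| <= r]).
  exact: compact_setX.
by apply/seteqP; split=> z /=; rewrite prod_normE ge_max => /andP.
Qed.

Definition cutoff (r x : R) : R := (`|x| <= r)%R%:R.

Lemma cutoff_ge0 r x : 0 <= cutoff r x. Proof. exact: ler0n. Qed.

Lemma measurable_cutoff r : measurable_fun setT (cutoff r).
Proof.
rewrite (_ : cutoff r = \1_(`[- r, r]%classic)); first exact: measurable_indic.
apply/funext => x; rewrite /cutoff indicE ler_norml.
by have -> : (x \in `[- r, r]%classic) = (- r <= x <= r)
  by apply/idP/idP; rewrite inE /= in_itv.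
Qed.

Lemma boxprod_cutoff (z : Z) r : 0 <= r -> boxprod (cutoff r) z = (`|z| <= r)%R%:R.
Proof.
move=> r0; have [/norm_leP-/(_ r0)[z1 z2]|/negP zr] := boolP (`|z| <= r).
  by rewrite /boxprod !big1 ?mulr1// => i _; rewrite /cutoff ?z1 ?z2.
apply/eqP; rewrite /boxprod mulf_eq0; apply: contra_notT zr.
rewrite negb_or => /andP[/prodf_neq0 z1 /prodf_neq0 z2]; apply/(norm_leP _ r0).
by split=> i; [move: (z1 i isT)|move: (z2 i isT)]; rewrite /cutoff; case: (_ <= _); rewrite ?eqxx.
Qed.

Lemma integral_cutoff_cos2X m (L : nat) :
  (\int[lebesgue_measure]_x (cutoff (L%:R / 2) x * cos2X m x)%:E =
    (L%:R * cos2X_mass R m)%:E)%E.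
Proof.
rewrite -Rintegral_cos2X /Rintegral fineK; last first.
  apply: integrable_fin_num => //.
  by apply: integrable_cont_itv; exact: continuous_cos2X.
rewrite [RHS]integral_mkcond; apply: eq_integral => x _.
rewrite patchE /cutoff; case: ifPn.
  by rewrite inE /= in_itv /= -ler_norml => ->; rewrite mul1r.
rewrite notin_setE /= in_itv /= -ler_norml => /negP/negbTE ->.
by rewrite mul0r.
Qed.

(** The weight psi^m restricted to the cube of side L centred at 0, which has the measure of L^(2n)
    periods; for m = 0 it is the indicator of the cube. *)
Definition cutoff_cos2X (L m : nat) : Z -> R :=
  boxprod (fun x => cutoff (L%:R / 2) x * cos2X m x).

Lemma measurable_cutoff_cos2X1 (L m : nat) :
  measurable_fun setT (fun x : R => cutoff (L%:R / 2) x * cos2X m x).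
Proof.
apply: measurable_funM; first exact: measurable_cutoff.
exact: continuous_measurable_fun (@continuous_cos2X R m).
Qed.

Lemma integral_cutoff_cos2X2 (L m : nat) :
  (\int[lam2]_z (cutoff_cos2X L m z)%:E = ((L%:R * cos2X_mass R m) ^+ N)%:E)%E.
Proof.
apply: integral_boxprod; first exact: measurable_cutoff_cos2X1.
  by move=> x; rewrite mulr_ge0 ?cutoff_ge0 ?cos2X_ge0.
exact: integral_cutoff_cos2X.
Qed.

Lemma cutoff_cos2X_ge0 L m z : 0 <= cutoff_cos2X L m z.
Proof. by apply: boxprod_ge0 => x; rewrite mulr_ge0 ?cutoff_ge0 ?cos2X_ge0. Qed.

Lemma integrable_cutoff_cos2X L m : lam2.-integrable setT (EFin \o cutoff_cos2X L m).
Proof.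
apply/integrableP; split.
  by apply/measurable_EFinP; apply: measurable_boxprod; exact: measurable_cutoff_cos2X1.
under eq_integral do rewrite /= ger0_norm ?cutoff_cos2X_ge0//.
by rewrite integral_cutoff_cos2X2 ltry.
Qed.

Lemma Rintegral_cutoff_cos2X L m :
  \int[lam2]_z cutoff_cos2X L m z = (L%:R * cos2X_mass R m) ^+ N.
Proof. by rewrite /Rintegral integral_cutoff_cos2X2. Qed.

Lemma cutoff_cos2XE L m z :
  cutoff_cos2X L m z = (`|z| <= L%:R / 2)%R%:R * boxprod (@cos2X R 1) z ^+ m.
Proof.
rewrite /cutoff_cos2X boxprodM boxprod_cutoff ?divr_ge0// -boxprodX.
by congr (_ * boxprod _ _); apply/funext => x; rewrite /cos2X expr1.
Qed.

Lemma cos2X_mass0 : cos2X_mass R 0 = 1.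
Proof.
rewrite /cos2X_mass /cos2X; under eq_Rintegral do rewrite expr0.
rewrite Rintegral_cst//= lebesgue_measure_itv /= lte_fin ifT; last by lra.
by rewrite /= mul1r; field.
Qed.

Lemma cos2X_mass_gt0 m : 0 < cos2X_mass R m.
Proof.
have pi0 := pi_gt0 R.
have h : 0 < (4^-1 : R) <= 1 / 2 by apply/andP; split; lra.
apply: lt_le_trans (cos2X_mass_ge m h).
have c0 : 0 < cos (pi * 4^-1 : R).
  by apply: cos_gt0_pihalf; apply/andP; split; lra.
have d0 : 0 < 2 * 4^-1 :> R by lra.
by apply: mulr_gt0 => //; rewrite /cos2X !exprn_gt0.
Qed.

(** The maximum is attained, so a strict bound holds with a margin. *)
Lemma continuous_compact_le (K : set Z) (g : Z -> R) (b : R) : compact K ->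
  continuous g -> (forall z, K z -> g z < b) -> exists2 q, q < b & forall z, K z -> g z <= q.
Proof.
move=> cK cg gb; have [->|/set0P K0] := eqVneq K set0.
  by exists (b - 1) => [|z []]; rewrite gtrDl oppr_lt0.
have [z zK zmax] := compact_EVT_max K0 cK (continuous_subspaceT cg).
exists (g z) => [|y Ky]; first by apply: gb; rewrite inE in zK.
by apply: zmax; rewrite inE.
Qed.

(** All factors lie in [0, 1], so a product equal to 1 forces each factor to be 1 and each
    coordinate to be an integer. *)
Lemma boxprod_cos2X_lt1 (z : Z) :
  ~ ((forall i, z.1 ord0 i \is a Num.int) /\ (forall i, z.2 ord0 i \is a Num.int)) ->
  boxprod (cos2X 1) z < 1.
Proof.
move=> nint; have g01 (x : R) : 0 <= cos2X 1 x <= 1 by rewrite cos2X_ge0 cos2X_le1.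
rewrite lt_neqAle boxprod_le1// andbT; apply/eqP => E; apply: nint.
have le1 (x : R) : 1 <= cos2X 1 x -> x \is a Num.int.
  by move=> x1; apply: cos2X_eq1; apply/eqP; rewrite eq_le x1 cos2X_le1.
by split=> i; apply: le1; rewrite -E; have [] := boxprod_le_coord z i g01.
Qed.

(* With the weight boxprod (cos2X m), F is at most F 0 + eta on the unit cube and at most
   eta elsewhere, except on the compact set K, which has no integer points. On K the weight
   is at most q ^+ m with q < 1, which is exponentially smaller than its total mass. *)
Lemma posdef_le_origin_compact (F : Z -> R) (A : nat) : posdef F -> continuous F ->
  (forall z : Z, A%:R < `|z| -> F z = 0) ->
  (forall z : Z, z != 0 -> (forall i, z.1 ord0 i \is a Num.int) ->
    (forall i, z.2 ord0 i \is a Num.int) -> F z <= 0) ->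
  \int[lam2]_z F z <= F 0.
Proof.
move=> PF cF F0 Fle0; have [Fi _] := PF.
(* The cube of side L has half-side A + 1, so it contains the support of F. *)
pose L := (A.+1 * 2)%N; have LE : L%:R / 2 = A.+1%:R :> R.
  by rewrite /L natrM mulfK.
apply/ler_addgt0Pr => e e0.
have L0 : 0 < (L%:R : R) ^+ N by rewrite exprn_gt0// ltr0n.
(* Chosen so that eta times the mass of the weight on the large cube is e / 2 times its mass on the
   unit cube. *)
pose eta := e / 2 / L%:R ^+ N.
have eta0 : 0 < eta by rewrite !divr_gt0.
pose K := [set z : Z | `|z| <= A.+1%:R] `&`
  (([set z : Z | 1 / 2 <= `|z|] `&` [set z | eta <= F z]) `|`
   ([set z : Z | `|z| <= 1 / 2] `&` [set z | F 0 + eta <= F z])).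
have cle (g : Z -> R) (b : R) : continuous g -> closed [set z | g z <= b].
  move=> cg; apply: (@preimage_closed _ _ g [set x | x <= b]); last exact: closed_le.
  by move=> z _; exact: cg.
have cge (g : Z -> R) (b : R) : continuous g -> closed [set z | b <= g z].
  move=> cg; apply: (@preimage_closed _ _ g [set x | b <= x]); last exact: closed_ge.
  by move=> z _; exact: cg.
have cn : continuous (fun z : Z => `|z|) by exact: norm_continuous.
have cK : compact K.
  apply: compact_closedI; first exact: compact_box.
  by apply: closedU; apply: closedI; [exact: cge|exact: cge|exact: cle|exact: cge].
(* A nonzero integer point has F <= 0 < eta and norm above 1 / 2; the origin has norm below 1 / 2
   and F 0 < F 0 + eta. So K contains no integer point. *)
have K1 z : K z -> boxprod (@cos2X R 1) z < 1.
  move=> [_ Kz]; apply: boxprod_cos2X_lt1 => -[i1 i2].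
  have z0 : z != 0 -> F z <= 0 by move=> z0; exact: Fle0.
  case: Kz => -[/= zh Fz].
    have {}z0 : z != 0.
      by apply/eqP => zE; move: zh; rewrite zE normr0; lra.
    by have := Fle0 _ z0 i1 i2; lra.
  have small (x : R) : x \is a Num.int -> `|x| <= 1 / 2 -> x = 0.
    move=> /intrP[k ->]; rewrite -intr_norm => kh.
    have : (`|k| < 1)%R by rewrite -(@ltr_int R); lra.
    by rewrite -[1]add0r ltzD1 normr_le0 => /eqP ->.
  have zE : z = 0.
    have h0 : 0 <= 1 / 2 :> R by lra.
    have [s1 s2] := norm_leP z h0 zh.
    case: z i1 i2 s1 s2 {zh Fz z0} => u v /= i1 i2 s1 s2.
    by congr (_, _); apply/rowP => i; rewrite mxE; exact: small.
  by move: Fz; rewrite zE; lra.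
have cpsi : continuous (@boxprod R n (cos2X 1)).
  by apply: continuous_boxprod; exact: continuous_cos2X.
have [q1 q1lt Kq1] := continuous_compact_le cK cpsi K1.
pose q := Num.max 0 q1.
have q01 : 0 <= q < 1 by rewrite /q le_max lexx /= gt_max ltr01.
have /andP[q0 q1'] := q01.
have Kq z : K z -> boxprod (@cos2X R 1) z <= q.
  by move=> Kz; rewrite /q le_max Kq1 ?orbT.
(* The exponent N fits the lower bound (2 d)^N (cos2X m d)^N for the mass of the weight on the unit
   cube, because (cos2X m d)^N = (cos2X N d)^m. *)
have [d /andP[d0 d12] qp] : exists2 d : R, 0 < d <= 1 / 2 & q < cos2X N d.
  have : \forall x \near (0 : R), q < cos2X N x.
    have c1 : cos2X N 0 = 1 :> R by rewrite /cos2X mulr0 cos0 !expr1n.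
    have := @continuous_cos2X R N 0; rewrite /continuous_at c1 => /cvgr_gt.
    exact.
  move=> /nbhs_ballP[r /= r0 rq]; exists (Num.min (r / 2) (1 / 2)).
    by rewrite lt_min ge_min lexx orbT !divr_gt0.
  apply: rq; rewrite /ball /= sub0r normrN ger0_norm.
    by rewrite gt_min; apply/orP; left; lra.
  by rewrite le_min !divr_ge0// ltW.
set p := cos2X N d in qp.
have p0 : 0 < p := le_lt_trans q0 qp.
have [B FB] : exists B, forall z, `|F z| <= B.
  have b0 : [set z : Z | `|z| <= A%:R] !=set0 by exists 0; rewrite /= normr0.
  have cFn : continuous (fun z => `|F z|).
    by move=> z; apply: cvg_norm; exact: cF.
  have [y yb ymax] := compact_EVT_max b0 (@compact_box A%:R) (continuous_subspaceT cFn).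
  exists `|F y| => z; have [zA|/F0 ->] := leP `|z| A%:R; last by rewrite normr0.
  by apply: ymax; rewrite inE.
have B0 : 0 <= B := le_trans (normr_ge0 _) (FB 0).
(* 2 B bounds F z - F 0, and adding 1 makes M positive. *)
pose M := 2 * B + 1.
have M0 : 0 < M by rewrite /M; lra.
have LN1 : 1 <= (L%:R : R) ^+ N by rewrite exprn_ege1// ler1n /L muln2 double_gt0.
have D0 : 0 < (2 * d) ^+ N by rewrite exprn_gt0// mulr_gt0.
have qp01 : 0 <= q / p < 1 by rewrite divr_ge0 ?(ltW p0)//= ltr_pdivrMr ?mul1r.
have e'0 : 0 < e / 2 * (2 * d) ^+ N / (M * L%:R ^+ N).
  by rewrite divr_gt0 ?mulr_gt0// divr_gt0.
(* Since q < p, the bound q^m on K becomes negligible against the lower bound (2 d)^N p^m for the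
   mass. *)
have [m mlt] := exists_expr_lt qp01 e'0.
set c := cos2X_mass R m.
have c0 : 0 < c := cos2X_mass_gt0 m.
have small : M * q ^+ m * L%:R ^+ N <= c ^+ N * (e / 2).
  have cLow : (2 * d) ^+ N * p ^+ m <= c ^+ N.
    have -> : p ^+ m = cos2X m d ^+ N.
      by rewrite /p /cos2X -!exprM; congr (_ ^+ _); rewrite mulnCA mulnC mulnA.
    rewrite -exprMn lerXn2r ?nnegrE ?(ltW c0)//.
      by rewrite mulr_ge0 ?cos2X_ge0// mulr_ge0// ltW.
    by apply: cos2X_mass_ge; rewrite d0.
  have e20 : 0 <= e / 2 by rewrite divr_ge0// ltW.
  apply: (@le_trans _ _ ((2 * d) ^+ N * p ^+ m * (e / 2))); last by rewrite ler_wpM2r.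
  move: mlt; rewrite expr_div_n ltr_pdivlMr ?mulr_gt0// => /ltW.
  rewrite -(ler_pM2r (exprn_gt0 m p0)).
  rewrite (_ : q ^+ m / p ^+ m * (M * L%:R ^+ N) * p ^+ m = M * q ^+ m * L%:R ^+ N); last first.
    by field; rewrite expf_neq0// gt_eqF.
  by move=> /le_trans; apply; rewrite le_eqVlt; apply/orP; left; apply/eqP; ring.
(* The terms account for F 0 on the unit cube, the tolerance eta on the large cube, and the points
   of K, where the weight is at most q^m. *)
pose U z := F 0 * cutoff_cos2X 1 m z + (eta * cutoff_cos2X L m z +
  M * q ^+ m * cutoff_cos2X L 0 z).
have pointwise z : F z * boxprod (@cos2X R m) z <= U z.
  have -> : boxprod (@cos2X R m) z = boxprod (@cos2X R 1) z ^+ m.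
    by rewrite -boxprodX; congr (boxprod _ _); apply/funext => x; rewrite /cos2X expr1.
  rewrite /U !cutoff_cos2XE LE expr0 mulr1.
  set P := boxprod _ z ^+ m.
  have P0 : 0 <= P by rewrite exprn_ge0// boxprod_ge0// => x; exact: cos2X_ge0.
  have PK : K z -> P <= q ^+ m.
    move=> Kz; rewrite lerXn2r ?nnegrE ?Kq// boxprod_ge0// => x.
    exact: cos2X_ge0.
  have qm0 : 0 <= q ^+ m by rewrite exprn_ge0.
  have := FB z; rewrite ler_norml => /andP[FzB1 FzB2].
  have := FB 0; rewrite ler_norml => /andP[F0B1 F0B2].
  have A1 : A%:R < A.+1%:R :> R by rewrite ltr_nat.
  have A2 : 1 <= A.+1%:R :> R by rewrite ler1n.
  (* Outside the large cube F and all three cutoffs vanish. *)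
  have [zL|zL] := leP `|z| A.+1%:R; last first.
    rewrite F0 ?(lt_trans A1)// leNgt; have -> : `|z| <= 1%:R / 2 = false; last first.
      by rewrite !mul0r !mulr0 !addr0 ltxx.
    by apply/negbTE; rewrite -ltNge (lt_trans _ zL)//; lra.
  have [z1|z1] := leP `|z| (1%:R / 2); rewrite ?mul1r ?mulr1 ?mul0r ?mulr0 ?add0r.
    have [Fz|Fz] := ltP (F z) (F 0 + eta).
      have : 0 <= (F 0 + eta - F z) * P by rewrite mulr_ge0// subr_ge0 ltW.
      have := mulr_ge0 (ltW M0) qm0; lra.
    have PQ := PK (conj zL (or_intror (conj z1 Fz))).
    have : (F z - F 0) * P <= (2 * B) * q ^+ m by rewrite ler_pM//; lra.
    have := mulr_ge0 (ltW eta0) P0; rewrite /M; lra.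
  have [Fz|Fz] := ltP (F z) eta.
    have : 0 <= (eta - F z) * P by rewrite mulr_ge0// subr_ge0 ltW.
    have := mulr_ge0 (ltW M0) qm0; lra.
  have PQ := PK (conj zL (or_introl (conj (ltW z1) Fz))).
  have : F z * P <= B * q ^+ m by rewrite ler_pM//; lra.
  have := mulr_ge0 (ltW eta0) P0; have := mulr_ge0 B0 qm0; rewrite /M; lra.
have iU k L' m' : lam2.-integrable setT (EFin \o (fun z => k * cutoff_cos2X L' m' z)).
  by have := integrableZl measurableT k (integrable_cutoff_cos2X L' m').
have iU2 : lam2.-integrable setT (EFin \o (fun z => eta * cutoff_cos2X L m z +
    M * q ^+ m * cutoff_cos2X L 0 z)).
  by have := integrableD measurableT (iU eta L m) (iU (M * q ^+ m) L 0%N).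
have iU3 : lam2.-integrable setT (EFin \o U).
  by have := integrableD measurableT (iU (F 0) 1%N m) iU2.
have iFP : lam2.-integrable setT (EFin \o (fun z => F z * boxprod (@cos2X R m) z)).
  apply: integrable_mul_le1 => //.
    by apply: measurable_boxprod; exact: continuous_measurable_fun (@continuous_cos2X R m).
  move=> z; rewrite ger0_norm ?boxprod_ge0 ?boxprod_le1// => x.
    by rewrite cos2X_ge0 cos2X_le1.
  exact: cos2X_ge0.
have := le_Rintegral measurableT iFP iU3 (fun z _ => pointwise z).
move=> /(le_trans (posdef_boxprod_cos2X m PF)).
rewrite /U RintegralD// RintegralD// !RintegralZl//; try exact: integrable_cutoff_cos2X.
rewrite !Rintegral_cutoff_cos2X cos2X_mass0 mul1r mulr1 -/c => h.
have cN0 : 0 < c ^+ N by rewrite exprn_gt0.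
(* The three terms of U integrate to F 0 c^N, c^N e / 2 and M q^m L^N; the last is at most c^N e / 2
   by [small]. *)
suff : c ^+ N * \int[lam2]_z F z <= c ^+ N * (F 0 + e) by rewrite ler_pM2l.
apply: (le_trans h).
rewrite mulrDr (mulrC (F 0)) lerD2l exprMn.
have -> : eta * (L%:R ^+ N * c ^+ N) = c ^+ N * (e / 2).
  by rewrite /eta; field; rewrite gt_eqF.
rewrite {2}(splitr e) mulrDr lerD2l.
exact: small.
Qed.

End summation.

(** * From compact support to integrable functions *)

Section summation_general.
Context (R : realType) (n : nat).
Notation Z := ('rV[R]_n * 'rV[R]_n)%type.
Notation lam2 := (lebesgue_rV2 R n).

Lemma boxprodZ (g : R -> R) (s : R) (z : Z) :
  boxprod (fun x => g (s * x)) z = boxprod g (s *: z).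
Proof. by rewrite /boxprod; congr (_ * _); apply: eq_bigr => i _; rewrite mxE. Qed.

(** The tents W_k of width k + 1 preserve [posdef], equal 1 at the origin and tend pointwise to 1.
    The compact case bounds the integral of F W_k by F 0, and dominated convergence with majorant
    |F| gives the limit. *)
Lemma posdef_le_origin (F : Z -> R) : posdef F -> continuous F ->
  (forall z : Z, z != 0 -> (forall i, z.1 ord0 i \is a Num.int) ->
    (forall i, z.2 ord0 i \is a Num.int) -> F z <= 0) ->
  \int[lam2]_z F z <= F 0.
Proof.
move=> PF cF Fle0; have [Fi _] := PF.
pose W k : Z -> R := boxprod (fun x => tent (k.+1%:R^-1 * x)).
have W01 k z : 0 <= W k z <= 1.
  by rewrite boxprod_ge0 ?boxprod_le1// => x;
    [exact: tent_bound|case/andP: (tent_bound (k.+1%:R^-1 * x))].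
have W0 k : W k 0 = 1.
  by rewrite /W boxprodZ scaler0 /boxprod !big1 ?mulr1// => i _;
    rewrite mxE /tent normr0 subr0 max_r.
have bound k : \int[lam2]_z (F z * W k z) <= F 0.
  rewrite -[leRHS]mulr1 -(W0 k).
  apply: (@posdef_le_origin_compact _ _ (fun z => F z * W k z) k.+1).
  - exact: posdef_boxprod_tent.
  - move=> z; apply: cvgM; first exact: cF.
    apply: continuous_boxprod => x.
    by apply: continuous_comp; [exact: mulrl_continuous|exact: continuous_tent].
  (* The one-dimensional tent vanishes beyond k + 1, so inserting the cutoff changes nothing and
     exhibits the support. *)
  - move=> z zk; rewrite /W (_ : (fun x => tent _) =
        (fun x => tent (k.+1%:R^-1 * x) * cutoff k.+1%:R x)).
      by rewrite boxprodM boxprod_cutoff// leNgt zk /= !mulr0.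
    apply/funext => x; rewrite /cutoff; case: leP => kx; rewrite ?mulr1// mulr0.
    rewrite /tent max_l// normrM normfV normr_nat subr_le0 ler_pdivlMl ?ltr0n//.
    by rewrite mulr1 ltW.
  - move=> z z0 z1 z2; rewrite -oppr_ge0 -mulNr mulr_ge0//.
      by rewrite oppr_ge0 Fle0.
    by case/andP: (W01 k z).
have mW k : measurable_fun setT (W k).
  apply: measurable_boxprod; apply: (measurableT_comp (@measurable_tent R)).
  exact: measurable_funM.
have mF := (measurable_EFinP _ _).1 (measurable_int _ Fi).
have cvgW z : F z * W k z @[k --> \oo] --> F z.
  rewrite -[X in _ --> X]mulr1; apply: cvgM; first exact: cvg_cst.
  have b1 : boxprod (@tent R) (0 : Z) = 1 by rewrite -[RHS](W0 0%N) /W boxprodZ scaler0.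
  have h0 : (k.+1%:R^-1 : R) *: z @[k --> \oo] --> (0 : Z).
    rewrite -(scale0r z); by apply: cvgZ; [exact: cvg_harmonic|exact: cvg_cst].
  rewrite -b1 /W; under eq_fun do rewrite boxprodZ.
  apply: (cvg_comp _ _ h0).
  exact: (continuous_boxprod (@continuous_tent R)).
have mFW k : measurable_fun setT (fun z => (F z * W k z)%:E).
  by apply/measurable_EFinP; exact: measurable_funM.
have cvgE : {ae lam2, forall z, setT z -> (F z * W k z)%:E @[k --> \oo] --> (F z)%:E}.
  by apply: aeW => z _; apply: cvg_EFin; [exact: nearW|exact: cvgW].
have domE : {ae lam2, forall z k, setT z -> (`|(F z * W k z)%:E| <= `|(F z)%:E|)%E}.
  apply: aeW => z k _; rewrite lee_fin normrM ler_piMr//.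
  by have /andP[w0 w1] := W01 k z; rewrite ger0_norm.
have [_ _ cvgI] := dominated_convergence measurableT mFW
  (measurable_int _ Fi) cvgE (integrable_abse Fi) domE.
rewrite -lee_fin -EFin_Rintegral//.
apply: (cvge_to_le cvgI); apply: nearW => k.
rewrite /= EFin_Rintegral ?lee_fin//.
by have [] := posdef_boxprod_tent k.+1%:R^-1 PF.
Qed.

End summation_general.

(** * Lattice packings *)

Section geometry.
Context (R : realType) (n : nat).
Notation Z := ('rV[R]_n * 'rV[R]_n)%type.
Notation lam2 := (lebesgue_rV2 R n).
Implicit Types (x y v : 'rV[R]_n) (B : 'M[R]_n).

Lemma dotvE x y : dotv x y = (x *m y^T) 0 0.
Proof. by rewrite /dotv mxE; apply: eq_bigr => i _; rewrite mxE. Qed.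

Lemma enormZ (s : R) x : enorm (s *: x) = `|s| * enorm x.
Proof.
rewrite /enorm (_ : dotv (s *: x) (s *: x) = s ^+ 2 * dotv x x).
  by rewrite sqrtrM ?sqr_ge0// sqrtr_sqr.
rewrite /dotv mulr_sumr; apply: eq_bigr => i _; rewrite !mxE.
by ring.
Qed.

Lemma enorm0 : enorm (0 : 'rV[R]_n) = 0.
Proof. by rewrite -(scale0r 0) enormZ normr0 mul0r. Qed.

Lemma continuous_enorm : continuous (@enorm R n).
Proof.
move=> x; apply: (@continuous_comp _ _ _ (fun x => dotv x x) Num.sqrt); last first.
  exact: sqrt_continuous.
suff dc (s : seq 'I_n) :
  continuous (fun x : 'rV[R]_n => \sum_(i <- s) x ord0 i * x ord0 i) by exact: dc.
elim: s => [|i s IH] y.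
  rewrite (_ : (fun x => _) = cst 0); first exact: cst_continuous.
  by apply/funext => u; rewrite big_nil.
under eq_fun do rewrite big_cons.
have ci : {for y, continuous (fun x : 'rV[R]_n => x ord0 i)} by exact: coord_continuous.
have := cvgD (cvgM ci ci) (IH y).
exact.
Qed.

Lemma eball0Z (s rho : R) : 0 < s ->
  [set x | eball 0 rho (s^-1 *: x)] = eball (0 : 'rV[R]_n) (s * rho).
Proof.
move=> s0; apply/seteqP; split=> x; rewrite /eball /= !subr0 enormZ;
by rewrite gtr0_norm ?invr_gt0// ler_pdivrMl.
Qed.

Lemma measurable_eball0 (rho : R) : 0 < rho -> measurable (eball (0 : 'rV[R]_n) rho).
Proof.
move=> rho0.
have md : measurable_fun setT (fun x : 'rV[R]_n => dotv x x).
  apply: measurable_sum => i.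
  by apply: measurable_funM; exact: measurable_rV_coord.
rewrite (_ : eball _ _ = (fun x => dotv x x) @^-1` `]-oo, (rho ^+ 2)]%classic).
  exact: measurable_preimageT md (measurable_itv _).
have E x : (enorm x <= rho) = (dotv x x <= rho ^+ 2).
  by rewrite /enorm -[in LHS](gtr0_norm rho0) -sqrtr_sqr ler_sqrt ?sqr_ge0.
by apply/seteqP; split=> x; rewrite /eball /= subr0 in_itv /= E.
Qed.

Lemma vol_scale (s : R) (A : set 'rV[R]_n) : 0 < s -> measurable A ->
  vol [set x | A (s^-1 *: x)] = covolume (s%:M : 'M[R]_n) * vol A.
Proof.
move=> s0 mA.
have us : (s%:M : 'M[R]_n) \in unitmx.
  by rewrite unitmxE det_scalar unitfE expf_neq0// gt_eqF.
have -> : [set x | A (s^-1 *: x)] = [set x | A (x *m invmx (s%:M : 'M[R]_n))].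
  by apply/seteqP; split=> x /=; rewrite invmx_scalar mul_mx_scalar.
rewrite /vol lebesgue_rV_mulmx//.
have c0 := covolume_gt0 us; case: (lebesgue_rV R n A) => [a| |] //=.
(* For infinite measure [fine] returns 0 on both sides. *)
- by rewrite gt0_muley ?lte_fin// mulr0.
- by rewrite gt0_muleNy ?lte_fin// mulr0.
Qed.

Lemma lattice0 B : lattice B 0.
Proof. by exists 0 => //; rewrite map_mx0 mul0mx. Qed.

Lemma latticeD B x y : lattice B x -> lattice B y -> lattice B (x + y).
Proof.
by move=> [a _ <-] [b _ <-]; exists (a + b) => //; rewrite map_mxD mulmxDl.
Qed.

Lemma latticeN B x : lattice B x -> lattice B (- x).
Proof. by move=> [a _ <-]; exists (- a) => //; rewrite map_mxN mulNmx. Qed.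

Lemma latticeZ B (s : R) x : lattice (s *: B) x -> exists2 y, lattice B y & x = s *: y.
Proof.
move=> [a _ <-]; exists (map_mx intr a *m B); last by rewrite scalemxAr.
by exists a.
Qed.

(* Otherwise the midpoint x / 2 is interior to both balls. *)
Lemma packing_enorm_ge B rho x : is_lattice_packing B rho -> lattice B x -> x != 0 ->
  2 * rho <= enorm x.
Proof.
move=> [uB rho0 tB] Lx x0; rewrite leNgt; apply/negP => xlt.
(* Interiors refer to the topology of the sup norm; continuity of [enorm] makes a point at Euclidean
   distance below rho interior. *)
have int (y : 'rV[R]_n) : enorm (2^-1 *: x - y) < rho -> (eball y rho)° (2^-1 *: x).
  move=> ylt; rewrite /interior /=.
  have c : (fun v => enorm (v - y)) @ (2^-1 *: x) --> enorm (2^-1 *: x - y).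
    have ci : v @[v --> 2^-1 *: x] --> 2^-1 *: x by exact: cvg_id.
    have cy : v - y @[v --> 2^-1 *: x] --> 2^-1 *: x - y by exact: cvgB ci (cvg_cst y).
    exact: cvg_comp cy (@continuous_enorm _).
  exact: (cvgr_le _ c _ ylt).
have half : 2^-1 * enorm x < rho by rewrite mulrC ltr_pdivrMr// mulrC.
move/eqP: x0; apply; apply/esym; apply: tB => //; first exact: lattice0.
exists (2^-1 *: x); split; apply: int.
  by rewrite subr0 enormZ ger0_norm.
rewrite (_ : 2^-1 *: x - x = - 2^-1 *: x).
  by rewrite enormZ normrN ger0_norm.
rewrite -[X in _ - X]scale1r -scalerBl; congr (_ *: _).
by field.
Qed.

Lemma continuous_mulmx2 B : continuous (mulmx2 B).
Proof.
have cB : continuous (fun v : 'rV[R]_n => v *m B).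
  move=> v.
  have E (u : 'rV[R]_n) : u *m B = \sum_i u ord0 i *: row i B by rewrite mulmx_sum_row.
  rewrite (funext E).
  suff sc (s : seq 'I_n) : continuous (fun u : 'rV[R]_n => \sum_(i <- s) u ord0 i *: row i B).
    exact: sc.
  elim: s => [|i s IH] y.
    rewrite (_ : (fun u => _) = cst 0); first exact: cst_continuous.
    by apply/funext => u; rewrite big_nil.
  under eq_fun do rewrite big_cons.
  have ci : {for y, continuous (fun u : 'rV[R]_n => u ord0 i)} by exact: coord_continuous.
  have := cvgD (cvgZ ci (cvg_cst (row i B))) (IH y).
  exact.
move=> z.
have c1 : {for z, continuous (fun z : Z => z.1 *m B)}.
  by apply: (@continuous_comp _ _ _ fst (fun v => v *m B)); [exact: cvg_fst|exact: cB].
have c2 : {for z, continuous (fun z : Z => z.2 *m B)}.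
  by apply: (@continuous_comp _ _ _ snd (fun v => v *m B)); [exact: cvg_snd|exact: cB].
exact: cvg_pair c1 c2.
Qed.

(** The dual vector w' is w transformed by the inverse transpose, so that pairing z B with w' gives
    the pairing of z with w; the Jacobian is positive. *)
Lemma posdef_mulmx2 (f : Z -> R) B : B \in unitmx -> posdef f ->
  posdef (f \o mulmx2 B).
Proof.
move=> uB [fi f0]; split; first exact: (integrable_mulmx2 uB fi).
move=> w; have c0 : 0 < covolume B ^+ 2 by rewrite exprn_gt0// covolume_gt0.
pose w' : Z := (w.1 *m (invmx B)^T, w.2 *m (invmx B)^T).
rewrite -(pmulr_rge0 _ c0); have := f0 w'.
rewrite (Rintegral_mulmx2 uB); last exact: integrable_cos_dotv2.
congr (0 <= _ * _); apply: eq_Rintegral => z _; congr (_ * cos _).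
by rewrite /dotv2 !dotvE /= !trmx_mul !trmxK !mulmxA !mulmxK.
Qed.

(** The cosine transform is the real part of the Fourier transform; dividing w by 2 pi absorbs the
    normalization. *)
Lemma fourier_posdef (f : Z -> R) : lam2.-integrable setT (EFin \o f) ->
  (forall w, 0 <= fourier f w) -> posdef f.
Proof.
move=> fi f0; split=> // w; have := f0 ((2 * pi)^-1 *: w).
rewrite lecE /= => /andP[_].
congr (0 <= _); apply: eq_Rintegral => z _.
rewrite /expi /= mul0r subr0 cosN dotv2Zr mulrA mulfV ?mul1r//.
by rewrite mulf_neq0// gt_eqF// pi_gt0.
Qed.

Lemma fourier_at0 (f : Z -> R) : fourier f (0, 0) = 1 -> \int[lam2]_z f z = 1.
Proof.
move=> /(congr1 (@complex.Re R)) /= <-; apply: eq_Rintegral => z _.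
have -> : dotv2 z (0, 0) = 0 by rewrite /dotv2 !dotvE /= trmx0 !mulmx0 mxE addr0.
by rewrite mulr0 oppr0 cos0 sin0 mulr1 mul0r subr0.
Qed.

(* Formally, by Poisson summation the left-hand side is at most covolume B ^+ 2 times the
   sum of f over the squared lattice, where only the term f 0 can be positive. *)
Lemma lattice_bound (r : R) (f : Z -> R) B : 0 < r -> continuous f -> posdef f ->
  (forall x y, (S_lat r `\` [set (0, 0)]) (x, y) -> f (x, y) <= 0) ->
  B \in unitmx -> (forall x, lattice B x -> x != 0 -> r <= enorm x) ->
  \int[lam2]_z f z <= covolume B ^+ 2 * f 0.
Proof.
move=> r0 cf Pf fle0 uB Bmin; have [fi _] := Pf.
rewrite (Rintegral_mulmx2 uB fi) ler_pM2l ?exprn_gt0 ?covolume_gt0//.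
have -> : f 0 = (f \o mulmx2 B) 0 by rewrite /= /mulmx2 !mul0mx.
apply: posdef_le_origin; first exact: posdef_mulmx2.
  by move=> z; apply: continuous_comp; [exact: continuous_mulmx2|exact: cf].
move=> z z0 z1 z2.
have lat (v : 'rV[R]_n) : (forall i, v ord0 i \is a Num.int) -> lattice B (v *m B).
  move=> vint; exists (map_mx Num.floor v) => //; congr (_ *m B).
  by apply/rowP => i; rewrite !mxE floorK.
have L1 := lat _ z1; have L2 := lat _ z2.
have D v : lattice B v -> ([set 0] `|` `[r, +oo[%classic) (enorm v).
  move=> Lv; have [->|v0] := eqVneq v 0; [left; exact: enorm0|right].
  by rewrite /= in_itv /= andbT Bmin.
(* Lattices are closed under sums and differences, so all four vectors in the definition of [S_lat]
   are lattice vectors. *)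
apply: fle0; split.
  split; apply: D => //=; apply: latticeD => //; exact: latticeN.
move=> /= -[E1 E2]; move/eqP: z0; apply.
have inj (v : 'rV[R]_n) : v *m B = 0 -> v = 0.
  by move=> E; rewrite -(mulmxK uB v) E mul0mx.
by rewrite [z]surjective_pairing (inj _ E1) (inj _ E2).
Qed.

End geometry.

(* The order on R[i] is the partial one: 0 <= fourier f w says that fourier f w
   is real and nonnegative. *)
Theorem theorem1p4 (R : realType) (n : nat) (hn : (1 <= n)%N) (r : R)
    (hr : 0 < r) (f : 'rV[R]_n * 'rV[R]_n -> R)
    (f_cont : continuous f)
    (f_int : (lebesgue_rV2 R n).-integrable [set: 'rV[R]_n * 'rV[R]_n]
               (EFin \o f))
    (fourier_ge0 : forall w : 'rV[R]_n * 'rV[R]_n, 0 <= fourier f w)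
    (fourier0 : fourier f (0, 0) = 1)
    (f_le0 : forall x y : 'rV[R]_n,
       (S_lat r `\` [set (0, 0)]) (x, y) -> f (x, y) <= 0) :
  (optimal_lattice_packing_density R n <=
     (vol (eball (0 : 'rV[R]_n) (r / 2)) * Num.sqrt (f (0, 0)))%:E)%E.
Proof.
apply: ge_ereal_sup => _ [[B rho] /= pack <-]; rewrite lee_fin.
have [uB rho0 _] := pack.
(* Scaling by s turns the minimal distance 2 rho into r. *)
pose s := r / (2 * rho); have s0 : 0 < s by rewrite divr_gt0// mulr_gt0.
have us : (s%:M : 'M[R]_n) \in unitmx.
  by rewrite unitmxE det_scalar unitfE expf_neq0// gt_eqF.
have usB : s *: B \in unitmx by rewrite -mul_scalar_mx unitmx_mul us.
have sBmin x : lattice (s *: B) x -> x != 0 -> r <= enorm x.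
  move=> /latticeZ[y Ly ->] sy0; rewrite enormZ gtr0_norm//.
  have y0 : y != 0 by apply: contraNneq sy0 => ->; rewrite scaler0.
  have := packing_enorm_ge pack Ly y0; rewrite -(ler_pM2l s0); apply: le_trans.
  by rewrite /s divfK// gt_eqF// mulr_gt0.
have Pf := fourier_posdef f_int fourier_ge0.
have := lattice_bound hr f_cont Pf f_le0 usB sBmin.
rewrite (fourier_at0 fourier0) => f1.
have c0 := covolume_gt0 usB.
have cs : covolume (s *: B) = covolume (s%:M : 'M[R]_n) * covolume B.
  by rewrite -mul_mx_scalar covolumeM.
have cB0 := covolume_gt0 uB; have cs0 := covolume_gt0 us.
rewrite /packing_density.
(* The density is invariant under scaling the balls and the lattice together. *)
have -> : vol (eball (0 : 'rV[R]_n) rho) / covolume B =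
    vol (eball (0 : 'rV[R]_n) (r / 2)) / covolume (s *: B).
  have -> : r / 2 = s * rho by rewrite /s; field; rewrite gt_eqF.
  rewrite -eball0Z// vol_scale//; last exact: measurable_eball0.
  by rewrite cs; field; rewrite !gt_eqF.
rewrite ler_wpM2l//; first exact: fine_ge0.
(* What remains is the square root of [f1]: 1 is at most the covolume times the square root of f(0,
   0). *)
rewrite -[leLHS]mul1r ler_pdivrMr// -(ger0_norm (ltW c0)) -sqrtr_sqr.
have f00 : 0 <= f (0, 0).
  rewrite leNgt; apply/negP => fneg.
  have := lt_le_trans ltr01 f1; rewrite pmulr_rgt0 ?exprn_gt0// => /lt_trans/(_ fneg).
  by rewrite ltxx.
by rewrite mulrC -sqrtrM ?sqr_ge0// -[leLHS]sqrtr1 ler_sqrt// mulr_ge0 ?sqr_ge0.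
Qed.
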